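(* Let $M$ be a connected manifold and let $F:A\to[0,\infty)$, $A\subset TM$, be a (Riemannianly) lower bounded conic pseudo-Finsler metric on $M$. Then the collection of subsets $\{B^+_F(p,r):p\in M,\ r>0\}$ (respectively, $\{B^-_F(p,r):p\in M,\ r>0\}$) constitutes a topological basis of $M$.
   Context: Let $\pi:TM\to M$ be the natural projection. A conic pseudo-Finsler metric on $M$ is a pair $(A,F)$ where $A\subset TM$ is open with $\pi(A)=M$ and conic ($v\in A$, $\lambda>0$ imply $\lambda v\in A$), and $F:A\to[0,\infty)$ is continuous, smooth on $A$ except at most at the zero vectors, with $F(v)=0$ iff $v$ is a zero vector and $F(\lambda v)=\lambda F(v)$ for $\lambda>0$, $v\in A$. $F$ is (Riemannianly) lower bounded if there exists a Riemannian metric $g_0$ on $M$ such that $F(v)\ge\sqrt{g_0(v,v)}$ for every $v\in A$. A piecewise smooth curve $\alpha:[a,b]\to M$ is ($F$-)admissible if its right and left derivatives $\dot\alpha_\pm(t)$ (those which make sense) belong to $A$ for every $t\in[a,b]$. Its length is $\ell_F(\alpha)=\int_a^bF(\dot\alpha(t))\,dt$. The Finslerian separation is $d_F(p,q)=\inf\ell_F(\alpha)\in[0,\infty]$, the infimum over all admissible piecewise smooth curves from $p$ to $q$ ($\infty$ if there are none). The forward and backward balls are $B^+_F(p,r)=\{q\in M:d_F(p,q)<r\}$ and $B^-_F(p,r)=\{q\in M:d_F(q,p)<r\}$. *)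

(* Defs.v *)
From HB Require Import structures.
From mathcomp Require Import all_boot all_order all_algebra.
From mathcomp Require Import all_classical all_reals all_analysis.

Set Implicit Arguments.
Unset Strict Implicit.
Unset Printing Implicit Defensive.
Import Order.TTheory GRing.Theory Num.Theory.
Import numFieldNormedType.Exports.
Local Open Scope classical_set_scope.
Local Open Scope ring_scope.

(* [U] is meant to be open and [V] finite-dimensional; then x |-> 'd f x is
   C^k on [U] iff all its evaluations x |-> 'D_v f x are. *)
Fixpoint Ck_on (R : realType) (V W : normedModType R) (k : nat)
    (U : set V) (f : V -> W) : Prop :=
  if k is k'.+1 then
    (forall x, U x -> differentiable f x) /\
    (forall v : V, Ck_on k' U (fun x => 'D_v f x : W))
  else {in U, continuous f}.

Definition smooth_on (R : realType) (V W : normedModType R)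
    (U : set V) (f : V -> W) : Prop := forall k, Ck_on k U f.

(* A homeomorphism between an open set of [M] and an open set of R^n; [cmap]
   and [cinv] take arbitrary values outside [cdom] and [ctgt]. *)
Record chart (R : realType) (n : nat) (M : topologicalType) := Chart {
  cdom : set M;
  ctgt : set 'rV[R]_n;
  cmap : M -> 'rV[R]_n;
  cinv : 'rV[R]_n -> M;
  cdom_open : open cdom;
  ctgt_open : open ctgt;
  cmap_tgt : forall p, cdom p -> ctgt (cmap p);
  cinv_dom : forall x, ctgt x -> cdom (cinv x);
  cmapK : forall p, cdom p -> cinv (cmap p) = p;
  cinvK : forall x, ctgt x -> cmap (cinv x) = x;
  cmap_continuous : {in cdom, continuous cmap};
  cinv_continuous : {in ctgt, continuous cinv}
}.

(* [chart_at] selects a preferred chart around every point; it is only used to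
   give tangent vectors a concrete representation. *)
Record smooth_manifold (R : realType) (n : nat) (M : topologicalType) :=
  SmoothManifold {
    mfd_hausdorff : hausdorff_space M;
    mfd_second_countable : @second_countable M;
    atlas : set (chart R n M);
    chart_at : M -> chart R n M;
    chart_at_atlas : forall p, atlas (chart_at p);
    chart_at_dom : forall p, cdom (chart_at p) p;
    transition_smooth : forall c d, atlas c -> atlas d ->
      smooth_on (ctgt c `&` cinv c @^-1` cdom d) (cmap d \o cinv c)
  }.

(* The tangent bundle. A vector of T_p M is represented by its coordinates in
   the preferred chart [chart_at S p], so that every T_p M is a copy of R^n with
   its usual linear structure; its coordinates in another chart are obtained
   through the differential of the transition map (see [chart_vec]). *)
Record TM (R : realType) (n : nat) (M : topologicalType)
    (S : smooth_manifold R n M) := Tangent {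
  foot : M;
  vec : 'rV[R]_n
}.
Arguments Tangent {R n M} S foot vec.

(* The tangent vector at [cinv c x] whose coordinates in the chart [c] are
   [u]. *)
Definition chart_vec (R : realType) (n : nat) (M : topologicalType)
    (S : smooth_manifold R n M) (c : chart R n M) (x u : 'rV[R]_n) : TM S :=
  Tangent S (cinv c x) ('D_u (cmap (chart_at S (cinv c x)) \o cinv c) x).

Section tangent_topology.
Context (R : realType) (n : nat) (M : topologicalType).
Variable S : smooth_manifold R n M.

HB.instance Definition _ := gen_eqMixin (TM S).
HB.instance Definition _ := gen_choiceMixin (TM S).

Definition chart_preimage (c : chart R n M) (A : set (TM S)) :
    set ('rV[R]_n * 'rV[R]_n) :=
  [set z | ctgt c z.1 /\ A (chart_vec S c z.1 z.2)].

Definition TM_open : set_system (TM S) :=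
  [set A | forall c, atlas S c -> open (chart_preimage c A)].

Let TM_openT : TM_open setT.
Proof.
move=> c _.
have -> : chart_preimage c setT = fst @^-1` ctgt c.
  by apply/seteqP; split=> [z []|z].
by apply: open_comp (@ctgt_open _ _ _ c) => z _; exact: cvg_fst.
Qed.

Let TM_openI : setI_closed TM_open.
Proof.
move=> A B oA oB c Sc.
have -> : chart_preimage c (A `&` B) = chart_preimage c A `&` chart_preimage c B.
  by apply/seteqP; split=> [z [? []]|z [[? ?] []]].
by apply: openI; [exact: oA|exact: oB].
Qed.

Let TM_open_bigU (I : Type) (f : I -> set (TM S)) :
  (forall i, TM_open (f i)) -> TM_open (\bigcup_i f i).
Proof.
move=> of_ c Sc.
have -> : chart_preimage c (\bigcup_i f i) = \bigcup_i chart_preimage c (f i).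
  by apply/seteqP; split=> [z [? [i _ ?]]|z [i _ []]]; [exists i|split=> //; exists i].
by apply: bigcup_open => i _; exact: of_.
Qed.

HB.instance Definition _ :=
  isOpenTopological.Build (TM S) TM_openT TM_openI TM_open_bigU.

End tangent_topology.

Section conic_Finsler.
Context (R : realType) (n : nat) (M : topologicalType).
Variable S : smooth_manifold R n M.
Implicit Types (A : set (TM S)) (F : TM S -> R) (v : TM S).

Definition scale_vec (a : R) v : TM S := Tangent S (foot v) (a *: vec v).

(* A smooth field of inner products; [g p] is defined on T_p M. *)
Record Riemannian_metric (g : M -> 'rV[R]_n -> 'rV[R]_n -> R) : Prop := {
  Riem_sym : forall p u w, g p u w = g p w u;
  Riem_linear : forall p a u u' w,
    g p (a *: u + u') w = a * g p u w + g p u' w;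
  Riem_pos : forall p u, u != 0 -> 0 < g p u u;
  Riem_smooth : forall c, atlas S c -> forall u w : 'rV[R]_n,
    smooth_on (ctgt c)
      (fun x => g (cinv c x) (vec (chart_vec S c x u)) (vec (chart_vec S c x w)))
}.

(* [F] takes arbitrary values outside [A]. *)
Record conic_pseudo_Finsler A F : Prop := {
  cpF_open : open A;
  cpF_foot : (@foot _ _ _ S) @` A = setT;
  cpF_conic : forall v (a : R), A v -> 0 < a -> A (scale_vec a v);
  cpF_ge0 : forall v, A v -> 0 <= F v;
  cpF_continuous : {within A, continuous F};
  cpF_smooth : forall c, atlas S c ->
    smooth_on (chart_preimage c (A `&` [set v | vec v != 0]))
      (fun z => F (chart_vec S c z.1 z.2));
  cpF_eq0 : forall v, A v -> (F v = 0 <-> vec v = 0);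
  cpF_homogeneous : forall v (a : R), A v -> 0 < a ->
    F (scale_vec a v) = a * F v
}.

Definition lower_bounded A F : Prop :=
  exists2 g0, Riemannian_metric g0 &
    forall v, A v -> Num.sqrt (g0 (foot v) (vec v) (vec v)) <= F v.

Definition smooth_curve (J : set R) (beta : R -> M) : Prop :=
  {in J, continuous beta} /\
  forall c, atlas S c ->
    smooth_on (J `&` beta @^-1` cdom c) (cmap c \o beta).

(* Smoothness on a compact interval is the existence of a smooth extension to a
   neighbourhood of it. *)
Definition smooth_arc (t0 t1 : R) (alpha : R -> M) : Prop :=
  exists (e : R) (beta : R -> M),
    [/\ 0 < e, smooth_curve `]t0 - e, t1 + e[ beta
      & {in `[t0, t1], alpha =1 beta}].

(* Only the restriction of [alpha] to [a, b] matters. *)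
Definition piecewise_smooth (a b : R) (alpha : R -> M) : Prop :=
  exists2 s : seq R, itv_partition a b s &
    forall i, (i < size s)%N -> smooth_arc (nth b (a :: s) i) (nth b s i) alpha.

Definition rvelocity (alpha : R -> M) (t : R) : TM S :=
  let phi := cmap (chart_at S (alpha t)) in
  Tangent S (alpha t)
    (lim (h^-1 *: (phi (alpha (t + h)) - phi (alpha t)) @[h --> 0^'+])).

Definition lvelocity (alpha : R -> M) (t : R) : TM S :=
  let phi := cmap (chart_at S (alpha t)) in
  Tangent S (alpha t)
    (lim (h^-1 *: (phi (alpha (t + h)) - phi (alpha t)) @[h --> 0^'-])).

Definition admissible A (a b : R) (alpha : R -> M) : Prop :=
  [/\ a < b, piecewise_smooth a b alpha,
      {in `[a, b[, forall t, A (rvelocity alpha t)}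
    & {in `]a, b], forall t, A (lvelocity alpha t)}].

(* The right velocity is the velocity except at finitely many instants. *)
Definition Flength F (a b : R) (alpha : R -> M) : \bar R :=
  (\int[@lebesgue_measure R]_(t in `[a, b[) (F (rvelocity alpha t))%:E)%E.

(* The infimum of the empty set is +oo. *)
Definition separation A F (p q : M) : \bar R :=
  ereal_inf [set l | exists (a b : R) (alpha : R -> M),
    [/\ admissible A a b alpha, alpha a = p, alpha b = q
      & l = Flength F a b alpha]].

Definition fball A F (p : M) (r : R) : set M :=
  [set q | (separation A F p q < r%:E)%E].

Definition bball A F (p : M) (r : R) : set M :=
  [set q | (separation A F q p < r%:E)%E].

End conic_Finsler.

(* Main.v *)
Require Import Defs.
From mathcomp Require Import all_boot all_order all_algebra.
From mathcomp Require Import all_classical all_reals all_analysis.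
From mathcomp Require Import measurable_realfun lra ring.
Import numFieldNormedType.Exports.
Local Open Scope classical_set_scope.
Local Open Scope ring_scope.

Set Implicit Arguments.
Unset Strict Implicit.
Unset Printing Implicit Defensive.
Import Order.TTheory GRing.Theory Num.Theory.

(* Balls are open: near the final velocity [v] of an admissible curve ending at
   [q], every pair (position, velocity) close to (q, v) lies in the open set [A]
   and [F] is bounded there, so a short final piece of the curve may be replaced
   by a coordinate segment that ends at an arbitrary point close to [q], at an
   arbitrarily small cost. The same segments give points at arbitrarily small
   separation from and to [q].

   Balls are small: around [q] the Riemannian lower bound dominates a multiple
   of the Euclidean norm of a chart, so a suitable multiple [f] of a C^1 bump
   function at [q] supported in a given neighbourhood of [q] satisfies
   |df(v)| <= F(v) on [A], whence |f(p') - f(p)| <= d(p, p'). A ball of radius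
   f(q)/2 that contains [q] therefore stays where [f] is positive. *)

(** Since [A] may be a narrow cone, [separation] can be infinite between arbitrarily close points,
    and a point need not lie in any ball centred at it. The triangle inequality alone thus gives
    neither openness nor a small ball centred at [q]: openness has to use the velocity with which a
    curve reaches its end, and the small balls around [q] are centred at a neighbouring point. For
    smallness, a function defined on all of [M] spares any discussion of the instant at which a
    curve leaves the chart: the bump is extended by zero and the inequality holds piece by piece
    wherever the curve goes. It bounds an absolute difference of values, so one function serves
    forward and backward balls alike. *)

(* The integral of a nonnegative function is a supremum over simple functions,
   so monotonicity and additivity in the domain need no measurability of the
   integrand. *)
Section nonmeasurable_integral.
Local Open Scope ereal_scope.
Import HBNNSimple.
Context d (T : measurableType d) (R : realType).
Variable mu : {measure set T -> \bar R}.
Implicit Types (f g : T -> \bar R) (D E : set T).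

Lemma nnsfun_integral_le f D (h : {nnsfun T >-> R}) :
  (forall x, (h x)%:E <= (f \_ D) x) -> (forall x, D x -> 0 <= f x) ->
  \int[mu]_x (h x)%:E <= \int[mu]_(x in D) f x.
Proof.
move=> hf f0; rewrite integralT_nnsfun ge0_integralE//.
by apply: ereal_sup_ubound; exists h.
Qed.

Lemma integral_le_nnsfun f D y : (forall x, D x -> 0 <= f x) ->
  (forall h : {nnsfun T >-> R}, (forall x, (h x)%:E <= (f \_ D) x) ->
     \int[mu]_x (h x)%:E <= y) ->
  \int[mu]_(x in D) f x <= y.
Proof.
move=> f0 hy; rewrite ge0_integralE//; apply: ge_ereal_sup => _ [h hf <-].
by rewrite -integralT_nnsfun; exact: hy.
Qed.

Lemma ge0_le_integral_lower f g D :
  (forall x, D x -> 0 <= f x) -> (forall x, D x -> f x <= g x) ->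
  \int[mu]_(x in D) f x <= \int[mu]_(x in D) g x.
Proof.
move=> f0 fg; apply: integral_le_nnsfun => // h hf.
apply: nnsfun_integral_le => [x|x Dx]; last exact: le_trans (f0 _ Dx) (fg _ Dx).
by apply: le_trans (hf x) _; apply: lee_restrict.
Qed.

Lemma ge0_subset_integral_lower f D E : D `<=` E ->
  (forall x, E x -> 0 <= f x) ->
  \int[mu]_(x in D) f x <= \int[mu]_(x in E) f x.
Proof.
move=> DE f0; apply: integral_le_nnsfun => [x /DE|h hf]; first exact: f0.
apply: nnsfun_integral_le => // x; apply: le_trans (hf x) _.
rewrite !patchE; case: ifPn => [/set_mem/DE/mem_set ->//|_].
by case: ifPn => [/set_mem/f0|].
Qed.

(** A simple function below [f] on the union is cut into its restrictions to [D] and [E];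
    conversely, simple functions below [f] on the two disjoint pieces add up to one below [f] on the
    union. *)
Lemma ge0_integral_setU_lower f D E : measurable D -> measurable E ->
  [disjoint D & E] -> (forall x, (D `|` E) x -> 0 <= f x) ->
  \int[mu]_(x in D `|` E) f x = \int[mu]_(x in D) f x + \int[mu]_(x in E) f x.
Proof.
move=> mD mE DE f0.
have fD x : D x -> 0 <= f x by move=> ?; apply: f0; left.
have fE x : E x -> 0 <= f x by move=> ?; apply: f0; right.
have dDE x : D x -> ~ E x.
  by move=> Dx Ex; move/disj_set2P/seteqP: DE => [DE _]; exact: (DE x).
apply/eqP; rewrite eq_le; apply/andP; split.
  apply: integral_le_nnsfun => // h hf.
  (* Being nonnegative and below a function that vanishes off the union, [h] vanishes there too. *)
  have -> : \int[mu]_x (h x)%:E = \int[mu]_(x in D `|` E) (h x)%:E.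
    rewrite [RHS]integral_mkcond; apply: eq_integral => x _.
    rewrite patchE; case: ifPn => // xDE; apply/eqP; rewrite eq_le.
    by have := hf x; rewrite patchE (negbTE xDE) => ->; rewrite lee_fin fun_ge0.
  rewrite ge0_integral_setU//; first last.
  - by move=> x _; rewrite lee_fin.
  - by apply/measurable_EFinP; apply: measurable_funTS.
  apply: leeD; apply: ge0_le_integral_lower => x Dx; rewrite ?lee_fin ?fun_ge0//.
  - by have := hf x; rewrite patchE mem_set//; left.
  - by have := hf x; rewrite patchE mem_set//; right.
have leD : \int[mu]_(x in D) f x <= \int[mu]_(x in D `|` E) f x.
  by apply: ge0_subset_integral_lower => //; exact: subsetUl.
have leE : \int[mu]_(x in E) f x <= \int[mu]_(x in D `|` E) f x.
  by apply: ge0_subset_integral_lower => //; exact: subsetUr.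
(* The two suprema are taken one after the other, each time with the other term subtracted from both
   sides; this requires finiteness, and the infinite cases follow from monotonicity. *)
have [Doo|Dfin] := eqVneq (\int[mu]_(x in D) f x) +oo.
  by move: leD; rewrite Doo leye_eq => /eqP ->; rewrite leey.
have [Eoo|Efin] := eqVneq (\int[mu]_(x in E) f x) +oo.
  by move: leE; rewrite Eoo leye_eq => /eqP ->; rewrite leey.
have finE : \int[mu]_(x in E) f x \is a fin_num.
  by rewrite ge0_fin_numE ?integral_ge0// ltey.
rewrite -leeBrDr//; apply: integral_le_nnsfun => // h1 hf1.
have finh1 : \int[mu]_x (h1 x)%:E \is a fin_num.
  rewrite ge0_fin_numE ?integral_ge0// => [|x _]; last by rewrite lee_fin.
  by rewrite (le_lt_trans (nnsfun_integral_le hf1 fD))// ltey.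
rewrite leeBrDr// addeC -leeBrDr//; apply: integral_le_nnsfun => // h2 hf2.
rewrite leeBrDr// -ge0_integralD//=; first last.
- exact/measurable_EFinP.
- by move=> x _; rewrite lee_fin.
- exact/measurable_EFinP.
- by move=> x _; rewrite lee_fin.
apply: (@nnsfun_integral_le _ _ (add_nnsfun h2 h1)) => // x /=.
rewrite EFinD; have := hf1 x; have := hf2 x; rewrite !patchE.
have [xD|xD] := boolP (x \in D); have [xE|xE] := boolP (x \in E).
- by case: (dDE x (set_mem xD) (set_mem xE)).
- rewrite mem_set; last by left; exact: set_mem.
  by move=> h20 h1f; rewrite -[leRHS]add0e leeD.
- rewrite mem_set; last by right; exact: set_mem.
  by move=> h2f h10; rewrite -[leRHS]adde0 leeD.
- rewrite memNset; last by case=> /mem_set; rewrite ?(negbTE xD) ?(negbTE xE).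
  by move=> h20 h10; rewrite -[leRHS]adde0 leeD.
Qed.

End nonmeasurable_integral.

(** * Smooth functions along straight lines *)

Section Ck.
Context (R : realType).

Lemma Ck_on_subset (V W : normedModType R) k (U U' : set V) (f : V -> W) :
  U' `<=` U -> Ck_on k U f -> Ck_on k U' f.
Proof.
move=> UU'; elim: k f => /= [|k IH] f.
  by move=> cf x /set_mem/UU' /mem_set; exact: cf.
by move=> [df Df]; split=> [x /UU'|v]; [exact: df|exact: IH].
Qed.

(** Openness of [U] turns equality on [U] into equality near each of its points, which passes to
    derivatives of every order. *)
Lemma eq_Ck_on (W : normedModType R) k (U : set R) (f g : R -> W) :
  open U -> {in U, f =1 g} -> Ck_on k U f -> Ck_on k U g.
Proof.
move=> oU; have nearU (f1 f2 : R -> W) x : {in U, f1 =1 f2} -> U x ->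
    {near x, f1 =1 f2}.
  move=> ff Ux; near=> y; apply: ff; apply/mem_set; near: y.
  exact: open_nbhs_nbhs.
elim: k f g => /= [|k IH] f g fg.
  move=> cf x xU; have fgx := nearU _ _ _ fg (set_mem xU).
  rewrite /continuous_at -fg//; apply: cvg_trans (cf x xU).
  by apply: near_eq_cvg; apply: filterS fgx => y ->.
move=> [df Df]; split=> [x Ux|v].
  apply/derivable1_diffP; apply: near_eq_derivable (nearU _ _ _ fg Ux) _.
  exact/derivable1_diffP/df.
apply: IH (Df v) => x /set_mem Ux; apply: near_eq_derive.
exact: nearU.
Unshelve. all: by end_near. Qed.

(** The base time [s0] allows a segment to be run over the same time interval as the piece of curve
    that it replaces. *)
Definition line (V : normedModType R) (x0 u : V) (s0 s : R) : V :=
  x0 + (s - s0) *: u.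

Lemma is_derive_line (V : normedModType R) (x0 u : V) (s0 t v : R) :
  is_derive t v (line x0 u s0) (v *: u).
Proof.
have Dl : h^-1 *: (line x0 u s0 (h *: v + t) - line x0 u s0 t) @[h --> 0^']
    --> v *: u.
  apply: cvg_near_cst; near=> h.
  rewrite /= /line opprD addrACA subrr add0r -scalerBl scalerA; congr (_ *: _).
  have h0 : h != 0 by near: h; exact: nbhs_dnbhs_neq.
  by rewrite /GRing.scale/=; field.
by split; [apply/cvg_ex; exists (v *: u)|exact: cvg_lim Dl].
Unshelve. all: by end_near. Qed.

Lemma differentiable_line (V : normedModType R) (x0 u : V) (s0 t : R) :
  differentiable (line x0 u s0) t.
Proof.
apply/derivable1_diffP.
exact: (@ex_derive _ _ _ _ _ _ _ (is_derive_line _ _ _ _ _)).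
Qed.

(** The differential of an affine map is constant, so the derivative of the composite in the
    direction [v] is the composite of ['D_(v *: u) f] with the same line. The induction on [k]
    therefore closes with no product rule, which is what makes segments that are straight in a chart
    convenient. *)
Lemma Ck_on_comp_line (V W : normedModType R) k (U : set V) (f : V -> W)
    (x0 u : V) (s0 : R) :
  open U -> Ck_on k U f ->
  Ck_on k (line x0 u s0 @^-1` U) (f \o line x0 u s0).
Proof.
move=> oU; elim: k f => /= [|k IH] f.
  move=> cf s /set_mem/= Us; apply: continuous_comp.
    exact/differentiable_continuous/differentiable_line.
  by apply: cf; exact/mem_set.
move=> [df Df]; split=> [s Us|v].
  by apply: differentiable_comp; [exact: differentiable_line|exact: df].
apply: eq_Ck_on (IH _ (Df (v *: u))).
  apply: open_comp => // s _.
  exact/differentiable_continuous/differentiable_line.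
move=> s /set_mem/= Us; rewrite deriveE; last exact: df.
have dl := differentiable_line x0 u s0 s.
rewrite deriveE; last by apply: differentiable_comp; [|exact: df].
rewrite [RHS](congr1 (fun h : R -> W => h v) (diff_comp dl (df _ Us))) /=.
by rewrite -(deriveE _ dl) (@derive_val _ _ _ _ _ _ _ (is_derive_line x0 u s0 s v)).
Qed.

End Ck.

(** * Piecewise smooth curves as chains of arcs *)

Section arcs.
Context (R : realType) (n : nat) (M : topologicalType).
Variable S : smooth_manifold R n M.
Implicit Types (alpha : R -> M).

(** A recursive form of [piecewise_smooth], for which cutting, concatenation and sums over the
    pieces become inductions. The chain may be empty, so cutting at an end point is no exception. *)
Inductive arcs alpha : R -> R -> Prop :=
| arcs_nil a : arcs alpha a a
| arcs_cons a c b : a < c -> smooth_arc S a c alpha -> arcs alpha c b ->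
    arcs alpha a b.

Lemma piecewise_smoothP a b alpha :
  piecewise_smooth S a b alpha <-> arcs alpha a b.
Proof.
split=> [[s]|].
  elim: s a => [|c s IH] a abs sm; first by rewrite (itv_partition_nil abs); left.
  have ac : a < c by case: abs => /= /andP[].
  apply: (arcs_cons ac); first exact: (sm 0%N).
  apply: IH; first exact: itv_partition_cons abs.
  by move=> i si; exact: (sm i.+1).
elim=> {a b} [a|a c b ac sac _ [s cbs sm]].
  by exists [::].
exists (c :: s); first by case: cbs => ? ?; split=> //=; exact/andP.
by case=> // i; exact: sm.
Qed.

Lemma arcs_le a b alpha : arcs alpha a b -> a <= b.
Proof.
by elim=> {a b} // a c b ac _ _; apply: le_trans; exact: ltW.
Qed.

Lemma smooth_arc_sub a b a' b' alpha : a <= a' -> b' <= b ->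
  smooth_arc S a b alpha -> smooth_arc S a' b' alpha.
Proof.
move=> aa' bb' [e [beta [e0 [cb sb] ab]]]; exists e, beta; split=> //.
  have JJ : `]a' - e, b' + e[%classic `<=` `]a - e, b + e[%classic.
    by apply: subset_itv; rewrite bnd_simp ?lerD2r.
  split=> [t tJ|c Sc k].
    by apply: cb; move: tJ; rewrite !inE; exact: JJ.
  by apply: Ck_on_subset (sb _ Sc k); exact: setSI.
move=> t /[!in_itv]/= /andP[a't tb']; apply: ab.
by rewrite in_itv/= (le_trans aa')// (le_trans tb').
Qed.

Lemma eq_smooth_arc a b alpha alpha' : {in `[a, b], alpha =1 alpha'} ->
  smooth_arc S a b alpha -> smooth_arc S a b alpha'.
Proof.
move=> aa' [e [beta [e0 sb ab]]]; exists e, beta; split=> // t tab.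
by rewrite -aa'// ab.
Qed.

Lemma eq_arcs a b alpha alpha' : {in `[a, b], alpha =1 alpha'} ->
  arcs alpha a b -> arcs alpha' a b.
Proof.
move=> + aab; elim: aab => {a b} [a _|a c b ac sac cb IH eqa]; first by left.
have cleb := arcs_le cb.
apply: (arcs_cons ac).
  apply: eq_smooth_arc sac => t; rewrite in_itv/= => /andP[at_ tc].
  by apply: eqa; rewrite in_itv/= at_ (le_trans tc).
apply: IH => t; rewrite in_itv/= => /andP[ct tb].
by apply: eqa; rewrite in_itv/= tb (le_trans (ltW ac)).
Qed.

Lemma arcs_cat a c b alpha : arcs alpha a c -> arcs alpha c b -> arcs alpha a b.
Proof.
by elim=> {a c} // a c c' ac sac _ IH /IH; exact: arcs_cons.
Qed.

Lemma arcs_split a c b alpha : arcs alpha a b -> a <= c <= b ->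
  arcs alpha a c /\ arcs alpha c b.
Proof.
elim=> {a b} [a|a d b ad sad db IH].
  by rewrite -eq_le => /eqP <-; split; left.
have [dc /andP[_ cb]|cd /andP[ac cb]] := leP d c.
  by have [|dc' cb'] := IH; [rewrite dc|split=> //; apply: arcs_cons dc'].
split.
  move: ac; rewrite le_eqVlt => /predU1P[<-|ac]; first by left.
  apply: (arcs_cons ac); last by left.
  by apply: smooth_arc_sub sad => //; exact: ltW.
apply: (arcs_cons cd) => //.
exact: smooth_arc_sub sad.
Qed.

Lemma arcs_first a b alpha : a < b -> arcs alpha a b ->
  exists2 c, a < c & smooth_arc S a c alpha.
Proof.
move=> + ab; case: a b / ab => [a|a c b ac sac _ _]; first by rewrite ltxx.
by exists c.
Qed.

Lemma arcs_last a b alpha : a < b -> arcs alpha a b ->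
  exists2 c, c < b & smooth_arc S c b alpha.
Proof.
move=> + ab; elim: ab => {a b} [a|a c b ac sac cb IH ab]; first by rewrite ltxx.
move: (arcs_le cb); rewrite le_eqVlt => /predU1P[<-|/IH//].
by exists a.
Qed.

End arcs.

(** * Velocities of curves in charts *)

Section velocity.
Context (R : realType) (n : nat) (M : topologicalType).
Variable S : smooth_manifold R n M.
Implicit Types (alpha beta : R -> M) (c : chart R n M).

Lemma near_cdom c (beta : R -> M) t : {for t, continuous beta} ->
  cdom c (beta t) -> \forall s \near t, cdom c (beta s).
Proof.
by move=> cb dt; apply: cb; apply: open_nbhs_nbhs; split=> //; exact: cdom_open.
Qed.

Lemma transition_differentiable c d x : atlas S c -> atlas S d ->
  ctgt c x -> cdom d (cinv c x) -> differentiable (cmap d \o cinv c) x.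
Proof.
by move=> Sc Sd cx dx; have [+ _] := transition_smooth Sc Sd 1; apply.
Qed.

Lemma smooth_curve_differentiable J beta c t : smooth_curve S J beta ->
  atlas S c -> J t -> cdom c (beta t) -> differentiable (cmap c \o beta) t.
Proof.
by move=> [_ sb] Sc Jt dt; have [+ _] := sb _ Sc 1%N; apply; split.
Qed.

Lemma smooth_curve_derive_continuous J beta c t : smooth_curve S J beta ->
  atlas S c -> J t -> cdom c (beta t) ->
  {for t, continuous ('D_1 (cmap c \o beta) : R -> _)}.
Proof.
move=> [_ sb] Sc Jt dt; have [_ /(_ 1)] := sb _ Sc 1%N.
by apply; apply/mem_set; split.
Qed.

(** Near [t] the curve read in [d] is the transition map after the curve read in [c], and the chain
    rule applies. With [d] the preferred chart, this identifies velocities, which are defined there,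
    with [chart_vec] of a derivative taken in any chart. *)
Lemma curve_chart_change c d beta t : atlas S c -> atlas S d ->
  {for t, continuous beta} -> cdom c (beta t) -> cdom d (beta t) ->
  differentiable (cmap c \o beta) t ->
  is_derive t 1 (cmap d \o beta)
    ('D_('D_1 (cmap c \o beta) t) (cmap d \o cinv c) (cmap c (beta t))).
Proof.
move=> Sc Sd cb ct dt db.
have tr : differentiable (cmap d \o cinv c) ((cmap c \o beta) t).
  by apply: transition_differentiable => //=; rewrite ?cmapK//; exact: cmap_tgt.
apply: (@near_eq_is_derive _ _ _ ((cmap d \o cinv c) \o (cmap c \o beta))).
  have := near_cdom cb ct; apply: filterS => s ds /=; rewrite cmapK//.
have dcomp := differentiable_comp db tr.
apply: DeriveDef; first exact: diff_derivable.
rewrite deriveE// [LHS](congr1 (fun h : R -> _ => h 1) (diff_comp db tr)) /=.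
by rewrite deriveE// deriveE.
Qed.

(** Here [beta] is meant to be the smooth extension of a piece of [alpha]. The two curves need to
    agree only to the right of [t]; the two-sided derivative of [beta] then supplies the one-sided
    limit. *)
Lemma rvelocityE alpha beta c t : atlas S c -> {for t, continuous beta} ->
  cdom c (beta t) -> differentiable (cmap c \o beta) t ->
  alpha t = beta t -> (\forall h \near 0^'+, alpha (t + h) = beta (t + h)) ->
  rvelocity S alpha t =
    chart_vec S c (cmap c (beta t)) ('D_1 (cmap c \o beta) t).
Proof.
move=> Sc cb ct db ab nab; rewrite /rvelocity /chart_vec cmapK// ab.
set d := chart_at S (beta t).
have [dd Dd] := curve_chart_change Sc (chart_at_atlas S (beta t)) cb ct
  (chart_at_dom S (beta t)) db.
congr Tangent; rewrite -Dd; apply: cvg_lim => //.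
apply: cvg_trans (cvg_dnbhs_at_right dd); apply: near_eq_cvg.
by apply: filterS nab => h /= ->; rewrite [h%:A]mulr1 (addrC t).
Qed.

Lemma lvelocityE alpha beta c t : atlas S c -> {for t, continuous beta} ->
  cdom c (beta t) -> differentiable (cmap c \o beta) t ->
  alpha t = beta t -> (\forall h \near 0^'-, alpha (t + h) = beta (t + h)) ->
  lvelocity S alpha t =
    chart_vec S c (cmap c (beta t)) ('D_1 (cmap c \o beta) t).
Proof.
move=> Sc cb ct db ab nab; rewrite /lvelocity /chart_vec cmapK// ab.
set d := chart_at S (beta t).
have [dd Dd] := curve_chart_change Sc (chart_at_atlas S (beta t)) cb ct
  (chart_at_dom S (beta t)) db.
congr Tangent; rewrite -Dd; apply: cvg_lim => //.
apply: cvg_trans (cvg_dnbhs_at_left dd); apply: near_eq_cvg.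
by apply: filterS nab => h /= ->; rewrite [h%:A]mulr1 (addrC t).
Qed.

Lemma eq_rvelocity alpha beta t : alpha t = beta t ->
  (\forall h \near 0^'+, alpha (t + h) = beta (t + h)) ->
  rvelocity S alpha t = rvelocity S beta t.
Proof.
move=> ab nab; rewrite /rvelocity ab; congr (Tangent _ _ (lim _)).
by rewrite eqEsubset; split; apply: near_eq_cvg; apply: filterS nab => h ->.
Qed.

Lemma eq_lvelocity alpha beta t : alpha t = beta t ->
  (\forall h \near 0^'-, alpha (t + h) = beta (t + h)) ->
  lvelocity S alpha t = lvelocity S beta t.
Proof.
move=> ab nab; rewrite /lvelocity ab; congr (Tangent _ _ (lim _)).
by rewrite eqEsubset; split; apply: near_eq_cvg; apply: filterS nab => h ->.
Qed.

(* In the preferred chart of its foot, a tangent vector is its own vector of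
   coordinates. *)
Lemma chart_vec_at (v : TM S) (c := chart_at S (foot v)) u :
  chart_vec S c (cmap c (foot v)) u = Tangent S (foot v) u.
Proof.
have dv := chart_at_dom S (foot v); rewrite /chart_vec cmapK//; congr Tangent.
rewrite (@near_eq_derive _ _ _ _ id) ?derive_id//.
have : nbhs (cmap c (foot v)) (ctgt c).
  by apply: open_nbhs_nbhs; split; [exact: ctgt_open|exact: cmap_tgt].
by apply: filterS => x cx /=; rewrite cinvK.
Qed.

Lemma near_right_lt (t b : R) : t < b -> \forall h \near 0^'+, t + h < b.
Proof.
move=> tb; near=> h; rewrite -ltrBrDl; near: h.
by apply: nbhs_right_lt; rewrite subr_gt0.
Unshelve. all: by end_near. Qed.

Lemma near_left_gt (a t : R) : a < t -> \forall h \near 0^'-, a < t + h.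
Proof.
move=> at_; near=> h; rewrite -ltrBlDl; near: h.
by apply: nbhs_left_gt; rewrite subr_lt0.
Unshelve. all: by end_near. Qed.

Section smooth_arc.
Variables (t0 t1 e : R) (alpha beta : R -> M).
Hypotheses (e0 : 0 < e) (sb : smooth_curve S `]t0 - e, t1 + e[ beta)
  (ab : {in `[t0, t1], alpha =1 beta}).

Lemma mem_smooth_arc t : t0 <= t <= t1 -> `]t0 - e, t1 + e[%classic t.
Proof. by move=> ?; rewrite /= in_itv/=; move: e0; lra. Qed.

Lemma smooth_arc_continuous t : t0 <= t <= t1 -> {for t, continuous beta}.
Proof. by move=> tt; apply: sb.1; exact/mem_set/mem_smooth_arc. Qed.

Lemma smooth_arc_rvelocity c t : atlas S c -> t0 <= t < t1 ->
  cdom c (beta t) ->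
  rvelocity S alpha t =
    chart_vec S c (cmap c (beta t)) ('D_1 (cmap c \o beta) t).
Proof.
move=> Sc /andP[t0t tt1] ct.
have tt : t0 <= t <= t1 by rewrite t0t ltW.
apply: rvelocityE => //.
- exact: smooth_arc_continuous.
- exact: (smooth_curve_differentiable sb Sc (mem_smooth_arc tt) ct).
- exact: ab.
near=> h; apply: ab; rewrite in_itv/=; apply/andP; split.
  by rewrite -[leLHS]addr0 lerD.
by near: h; apply: filterS (near_right_lt tt1) => h /ltW.
Unshelve. all: by end_near. Qed.

Lemma smooth_arc_lvelocity c t : atlas S c -> t0 < t <= t1 ->
  cdom c (beta t) ->
  lvelocity S alpha t =
    chart_vec S c (cmap c (beta t)) ('D_1 (cmap c \o beta) t).
Proof.
move=> Sc /andP[t0t tt1] ct.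
have tt : t0 <= t <= t1 by rewrite tt1 ltW.
apply: lvelocityE => //.
- exact: smooth_arc_continuous.
- exact: (smooth_curve_differentiable sb Sc (mem_smooth_arc tt) ct).
- exact: ab.
near=> h; apply: ab; rewrite in_itv/=; apply/andP; split.
  by near: h; apply: filterS (near_left_gt t0t) => h /ltW.
by rewrite -[leRHS]addr0 lerD.
Unshelve. all: by end_near. Qed.

End smooth_arc.
End velocity.

(** * Lengths, concatenation and segments *)

Section lengths.
Context (R : realType) (n : nat) (M : topologicalType).
Variables (S : smooth_manifold R n M) (A : set (TM S)) (F : TM S -> R).
Hypothesis hF : conic_pseudo_Finsler A F.
Implicit Types (alpha beta : R -> M).

Lemma admissible_Frvelocity_ge0 a b alpha t : admissible A a b alpha ->
  `[a, b[%classic t -> (0 <= (F (rvelocity S alpha t))%:E)%E.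
Proof. by move=> [_ _ Ar _] tab; rewrite lee_fin; apply: (cpF_ge0 hF); exact: Ar. Qed.

Lemma Flength_ge0 a b alpha : admissible A a b alpha ->
  (0 <= Flength F a b alpha)%E.
Proof.
by move=> adm; apply: integral_ge0 => t; exact: admissible_Frvelocity_ge0 adm.
Qed.

Lemma admissible_sub a b a' b' alpha : a <= a' -> a' < b' -> b' <= b ->
  admissible A a b alpha -> admissible A a' b' alpha.
Proof.
move=> aa' ab' bb' [ab /piecewise_smoothP pw Ar Al]; split=> //.
- apply/piecewise_smoothP.
  have [_ pw'] : arcs S alpha a a' /\ arcs S alpha a' b.
    by apply: arcs_split => //; rewrite aa' (le_trans (ltW ab')).
  by have [] := arcs_split pw' (c := b') _; rewrite ?(ltW ab').
- move=> t /[!in_itv]/= /andP[h1 h2]; apply: Ar; rewrite in_itv/=.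
  by rewrite (le_trans aa' h1) (lt_le_trans h2 bb').
- move=> t /[!in_itv]/= /andP[h1 h2]; apply: Al; rewrite in_itv/=.
  by rewrite (le_lt_trans aa' h1) (le_trans h2 bb').
Qed.

Lemma Flength_sub a b a' b' alpha : a <= a' -> b' <= b ->
  admissible A a b alpha -> (Flength F a' b' alpha <= Flength F a b alpha)%E.
Proof.
move=> aa' bb' adm; apply: ge0_subset_integral_lower.
  by apply: subset_itv; rewrite bnd_simp.
by move=> t; exact: admissible_Frvelocity_ge0 adm.
Qed.

Lemma Flength_split a c b alpha : a <= c -> c <= b ->
  {in `[a, b[, forall t, A (rvelocity S alpha t)} ->
  Flength F a b alpha = (Flength F a c alpha + Flength F c b alpha)%E.
Proof.
move=> ac cb Ar.
have Uab : `[a, b[%classic = `[a, c[ `|` `[c, b[.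
  by rewrite -itv_bndbnd_setU// bnd_simp.
have dis : [disjoint `[a, c[%classic & `[c, b[%classic].
  apply/disj_set2P; apply/seteqP; split=> // t [] /=.
  by rewrite !in_itv/= => /andP[_ tc] /andP[]; rewrite leNgt tc.
have ge0 t : (`[a, c[ `|` `[c, b[) t -> (0 <= (F (rvelocity S alpha t))%:E)%E.
  by rewrite -Uab => tab; rewrite lee_fin; apply: (cpF_ge0 hF); exact: Ar.
have mac : measurable (`[a, c[ : set (measurableTypeR R)).
  exact: measurable_itv.
have mcb : measurable (`[c, b[ : set (measurableTypeR R)).
  exact: measurable_itv.
rewrite /Flength Uab.
exact: (ge0_integral_setU_lower (@lebesgue_measure R) mac mcb dis ge0).
Qed.

Definition glue (c : R) alpha beta (t : R) : M :=
  if t < c then alpha t else beta t.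

Section glue.
Variables (a c b : R) (alpha beta : R -> M).
Hypotheses (Aalpha : admissible A a c alpha) (Abeta : admissible A c b beta).
Hypothesis abc : alpha c = beta c.

Lemma glue_le t : t <= c -> glue c alpha beta t = alpha t.
Proof.
by rewrite /glue le_eqVlt => /predU1P[->|->//]; rewrite ltxx.
Qed.

Lemma glue_ge t : c <= t -> glue c alpha beta t = beta t.
Proof. by rewrite /glue leNgt => /negbTE ->. Qed.

Lemma rvelocity_glue_lt t : t < c ->
  rvelocity S (glue c alpha beta) t = rvelocity S alpha t.
Proof.
move=> tc; apply: eq_rvelocity; first by rewrite glue_le// ltW.
by apply: filterS (near_right_lt tc) => h /ltW; exact: glue_le.
Qed.

Lemma rvelocity_glue_ge t : c <= t ->
  rvelocity S (glue c alpha beta) t = rvelocity S beta t.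
Proof.
move=> ct; apply: eq_rvelocity; first by rewrite glue_ge.
by near=> h; apply: glue_ge; rewrite -[leLHS]addr0 lerD.
Unshelve. all: by end_near. Qed.

Lemma lvelocity_glue_le t : t <= c ->
  lvelocity S (glue c alpha beta) t = lvelocity S alpha t.
Proof.
move=> tc; apply: eq_lvelocity; first by rewrite glue_le.
by near=> h; apply: glue_le; rewrite -[leRHS]addr0 lerD.
Unshelve. all: by end_near. Qed.

Lemma lvelocity_glue_gt t : c < t ->
  lvelocity S (glue c alpha beta) t = lvelocity S beta t.
Proof.
move=> tc; apply: eq_lvelocity; first by rewrite glue_ge// ltW.
by apply: filterS (near_left_gt tc) => h /ltW; exact: glue_ge.
Qed.

(** A corner at [c] is harmless: the left velocity there is that of [alpha], the right velocity that
    of [beta], and admissibility tests only one-sided velocities. *)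
Lemma admissible_glue : admissible A a b (glue c alpha beta).
Proof.
have [ac /piecewise_smoothP pa Ara Ala] := Aalpha.
have [cb /piecewise_smoothP pb Arb Alb] := Abeta.
split; first exact: lt_trans cb.
- apply/piecewise_smoothP; apply: (arcs_cat (c := c)).
    apply: eq_arcs pa => t /[!in_itv]/= /andP[_ tc].
    by rewrite glue_le.
  apply: eq_arcs pb => t /[!in_itv]/= /andP[ct _].
  by rewrite glue_ge.
- move=> t /[!in_itv]/= /andP[at_ tb]; have [tc|ct] := ltP t c.
    by rewrite rvelocity_glue_lt//; apply: Ara; rewrite in_itv/= at_.
  by rewrite rvelocity_glue_ge//; apply: Arb; rewrite in_itv/= ct.
- move=> t /[!in_itv]/= /andP[at_ tb]; have [tc|ct] := leP t c.
    by rewrite lvelocity_glue_le//; apply: Ala; rewrite in_itv/= at_.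
  by rewrite lvelocity_glue_gt//; apply: Alb; rewrite in_itv/= ct.
Qed.

Lemma Flength_glue : Flength F a b (glue c alpha beta) =
  (Flength F a c alpha + Flength F c b beta)%E.
Proof.
have [ac _ _ _] := Aalpha; have [cb _ _ _] := Abeta.
have [_ _ Ar _] := admissible_glue.
have gluel : Flength F a c (glue c alpha beta) = Flength F a c alpha.
  apply: eq_integral => t /set_mem/=; rewrite in_itv/= => /andP[_ tc].
  by rewrite rvelocity_glue_lt.
have gluer : Flength F c b (glue c alpha beta) = Flength F c b beta.
  apply: eq_integral => t /set_mem/=; rewrite in_itv/= => /andP[ct _].
  by rewrite rvelocity_glue_ge.
by rewrite (Flength_split (ltW ac) (ltW cb) Ar) gluel gluer.
Qed.

Lemma separation_glue :
  (separation A F (alpha a) (beta b) <=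
    Flength F a c alpha + Flength F c b beta)%E.
Proof.
have [ac _ _ _] := Aalpha; have [cb _ _ _] := Abeta.
apply: ereal_inf_lbound; exists a, b, (glue c alpha beta); split.
- exact: admissible_glue.
- by rewrite glue_le// ltW.
- by rewrite glue_ge// ltW.
- by rewrite Flength_glue.
Qed.

End glue.

Lemma separation_le_Flength a b alpha : admissible A a b alpha ->
  (separation A F (alpha a) (alpha b) <= Flength F a b alpha)%E.
Proof. by move=> adm; apply: ereal_inf_lbound; exists a, b, alpha. Qed.

Lemma separation_lt p q (r : R) : (separation A F p q < r%:E)%E ->
  exists a b alpha, [/\ admissible A a b alpha, alpha a = p, alpha b = q
    & (Flength F a b alpha < r%:E)%E].
Proof.
by move=> /ereal_inf_lt[_ [a [b [alpha [adm pa qb ->]]]] lr]; exists a, b, alpha.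
Qed.

End lengths.

(** * Coordinate segments with prescribed velocity *)

Section segments.
Context (R : realType) (n : nat) (M : topologicalType).
Variables (S : smooth_manifold R n M) (A : set (TM S)) (F : TM S -> R).
Hypothesis hF : conic_pseudo_Finsler A F.

(** Balls are convex: the point at time [s] is the convex combination of those at [s1] and [s2] with
    weight [w] on the latter. *)
Lemma line_ball (V : normedModType R) (x1 u y : V) (s0 s1 s2 s e : R) :
  s1 <= s <= s2 -> ball y e (line x1 u s0 s1) -> ball y e (line x1 u s0 s2) ->
  ball y e (line x1 u s0 s).
Proof.
move=> /andP[s1s ss2]; rewrite -!ball_normE /= => b1 b2.
have := le_trans s1s ss2; rewrite le_eqVlt => /predU1P[s12|s12].
  by have -> : s = s1 by apply/eqP; rewrite eq_le s1s s12 ss2.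
pose w := (s - s1) / (s2 - s1).
have s210 : s2 - s1 != 0 by rewrite subr_eq0 gt_eqF.
have w0 : 0 <= w by rewrite divr_ge0// subr_ge0// ltW.
have w1 : 0 <= 1 - w.
  by rewrite subr_ge0 ler_pdivrMr ?subr_gt0// mul1r lerD2r.
have -> : y - line x1 u s0 s =
    (1 - w) *: (y - line x1 u s0 s1) + w *: (y - line x1 u s0 s2).
  have E s' : y - line x1 u s0 s' = (y - x1) - (s' - s0) *: u.
    by rewrite /line opprD addrA.
  rewrite !E; move: (y - x1) => z; rewrite !scalerBr addrACA.
  rewrite -scalerDl subrK scale1r -opprD !scalerA -scalerDl.
  by congr (_ - _ *: u); rewrite /w; field.
(* The strict inequality will come from the second term alone, since [1 - w] may vanish; this needs
   [w > 0]. *)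
clearbody w; have [->|w_neq0] := eqVneq w 0; first by rewrite subr0 scale0r addr0 scale1r.
apply: le_lt_trans (ler_normD _ _) _; rewrite !normrZ (ger0_norm w0) (ger0_norm w1).
move: (ler_wpM2l w1 (ltW b1)).
have w_gt0 : 0 < w by rewrite lt_neqAle eq_sym w_neq0.
have : w * `|y - line x1 u s0 s2| < w * e by rewrite ltr_pM2l.
move=> h1 h2; have -> : e = (1 - w) * e + w * e by rewrite -mulrDl subrK mul1r.
exact: ler_ltD.
Qed.

(** Openness of [A] and continuity of [F] at [v] give an open set of tangent vectors on which
    [F < F v + 1], hence the constant [C]. By definition of the topology of [TM S], this set is open
    in the coordinates (position, velocity) of [c], where a ball of the product is a product of
    balls. *)
Lemma tangent_cone_nbhs (v : TM S) (c := chart_at S (foot v)) : A v ->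
  exists e C : R, [/\ 0 < e, 0 <= C & forall x u,
    ball (cmap c (foot v)) e x -> ball (vec v) e u ->
    [/\ ctgt c x, A (chart_vec S c x u) & F (chart_vec S c x u) <= C]].
Proof.
move=> Av; have oA := cpF_open hF.
have Fv : nbhs v (A `&` [set w | F w < F v + 1]).
  apply: filterI; first exact: open_nbhs_nbhs.
  have : {for v, continuous F}.
    move: (cpF_continuous hF); rewrite (continuous_open_subspace F oA).
    by apply; exact/mem_set.
  move=> cF; apply: (cF [set y | y < F v + 1]).
  by apply: open_nbhs_nbhs; split; [exact: open_lt|rewrite /= ltrDl].
move: Fv; rewrite nbhsE => -[W [oW Wv] WAF].
have Sc := chart_at_atlas S (foot v).
have cv : chart_preimage c W (cmap c (foot v), vec v).
  split=> /=; first exact/cmap_tgt/chart_at_dom.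
  have -> : chart_vec S c (cmap c (foot v)) (vec v) = v.
    by rewrite chart_vec_at; case: (v).
  exact: Wv.
have /nbhs_ballP[e /= e0 eW] := open_nbhs_nbhs (conj (oW c Sc) cv).
exists e, (F v + 1); split=> //; first by rewrite addr_ge0// (cpF_ge0 hF).
move=> x u xe ue; have [/= cx /WAF[Axu /ltW Fxu]] : chart_preimage c W (x, u).
  by apply: eW; split.
by split.
Qed.

Lemma open_transition_domain (c d : chart R n M) :
  open (ctgt c `&` cinv c @^-1` cdom d).
Proof.
rewrite openE => x [cx dx]; apply: filterI.
  by apply: open_nbhs_nbhs; split=> //; exact: ctgt_open.
apply: cinv_continuous; first exact/mem_set.
by apply: open_nbhs_nbhs; split=> //; exact: cdom_open.
Qed.

Lemma smooth_curve_line c (J : set R) (x1 u : 'rV[R]_n) (s0 : R) :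
  atlas S c -> (forall s, J s -> ctgt c (line x1 u s0 s)) ->
  smooth_curve S J (cinv c \o line x1 u s0).
Proof.
move=> Sc Jc; split=> [s /set_mem Js|d Sd k].
  apply: continuous_comp.
    exact/differentiable_continuous/differentiable_line.
  by apply: cinv_continuous; apply/mem_set/Jc.
have H := Ck_on_comp_line x1 u s0 (@open_transition_domain c d)
  (transition_smooth Sc Sd k).
apply: (Ck_on_subset _ H) => s [Js ds].
by split=> //; exact: Jc.
Qed.

Section segment.
Variables (v : TM S) (e C : R).
Let c := chart_at S (foot v).
Let x0 := cmap c (foot v).
Hypothesis eC : forall x u, ball x0 e x -> ball (vec v) e u ->
  [/\ ctgt c x, A (chart_vec S c x u) & F (chart_vec S c x u) <= C].
Variables (x1 u : 'rV[R]_n) (a b : R).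
Hypotheses (ab : a < b) (ua : ball x0 e (line x1 u a a))
  (ub : ball x0 e (line x1 u a b)) (uv : ball (vec v) e u).

Let gamma := cinv c \o line x1 u a.

Let line_ab t : a <= t <= b -> ball x0 e (line x1 u a t).
Proof. by move=> tab; exact: (line_ball tab). Qed.

(** A smooth arc must extend smoothly beyond its end points. The ball is open, so the line stays in
    it slightly before [a] and after [b], and by convexity at all times in between. *)
Let segment_arc : exists2 e', 0 < e' & smooth_curve S `]a - e', b + e'[ gamma.
Proof.
have cl (s : R) : {for s, continuous (line x1 u a)}.
  exact/differentiable_continuous/differentiable_line.
have near_ball s : ball x0 e (line x1 u a s) ->
    \forall t \near s, ball x0 e (line x1 u a t).
  move=> bs; apply: cl; apply: open_nbhs_nbhs; split=> //.
  exact: ball_open.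
have /nbhs_ballP[ea /= ea0 na] := near_ball _ ua.
have /nbhs_ballP[eb /= eb0 nb] := near_ball _ ub.
(* Halving makes [e'] strictly smaller than both radii, so that the times [a - e'] and [b + e']
   themselves are covered. *)
pose e' := Num.min ea eb / 2.
have e'0 : 0 < e' by rewrite divr_gt0// lt_min ea0.
have e'a : e' < ea.
  have : Num.min ea eb <= ea by rewrite ge_min lexx.
  by move: e'0; rewrite /e'; lra.
have e'b : e' < eb.
  have : Num.min ea eb <= eb by rewrite ge_min lexx orbT.
  by move: e'0; rewrite /e'; lra.
exists e' => //; apply: smooth_curve_line => [|s /=]; first exact: chart_at_atlas.
rewrite in_itv/= => /andP[/ltW as_ /ltW sb].
have sin : a - e' <= s <= b + e' by rewrite as_.
suff bs : ball x0 e (line x1 u a s) by have [] := eC bs uv.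
apply: (line_ball sin); [apply: na|apply: nb]; rewrite -ball_normE/=.
  by rewrite opprB addrC subrK gtr0_norm.
by rewrite opprD addrA subrr add0r normrN gtr0_norm.
Qed.

Let segment_velocity t : a <= t <= b -> 
  cmap c (gamma t) = line x1 u a t /\ 'D_1 (cmap c \o gamma) t = u.
Proof.
move=> tab; have bt := line_ab tab.
have [ct _ _] := eC bt uv; split; first by rewrite /gamma/= cinvK.
rewrite (@near_eq_derive _ _ _ _ (line x1 u a)).
  by rewrite (@derive_val _ _ _ _ _ _ _ (is_derive_line _ _ _ _ _)) scale1r.
have : \forall s \near t, ctgt c (line x1 u a s).
  have : {for t, continuous (line x1 u a)}.
    exact/differentiable_continuous/differentiable_line.
  by apply; apply: open_nbhs_nbhs; split=> //; exact: ctgt_open.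
by apply: filterS => s cs; rewrite /gamma/= cinvK.
Qed.

Lemma segment_admissible : admissible A a b gamma.
Proof.
have [e' e'0 sg] := segment_arc.
have Sc := chart_at_atlas S (foot v).
have dg t : a <= t <= b -> cdom c (gamma t).
  by move=> /line_ab bt; have [ct _ _] := eC bt uv; exact: cinv_dom.
split=> //.
- apply/piecewise_smoothP; apply: (arcs_cons ab); last by left.
  by exists e', gamma.
- move=> t /[!in_itv]/= /andP[at_ tb].
  have tab : a <= t <= b by rewrite at_ ltW.
  rewrite (smooth_arc_rvelocity e'0 sg _ Sc _ (dg _ tab))//; last by rewrite at_.
  have [-> ->] := segment_velocity tab.
  by have [] := eC (line_ab tab) uv.
- move=> t /[!in_itv]/= /andP[at_ tb].
  have tab : a <= t <= b by rewrite tb ltW.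
  rewrite (smooth_arc_lvelocity e'0 sg _ Sc _ (dg _ tab))//; last by rewrite at_.
  have [-> ->] := segment_velocity tab.
  by have [] := eC (line_ab tab) uv.
Qed.

Lemma segment_Flength : (Flength F a b gamma <= (C * (b - a))%:E)%E.
Proof.
have [e' e'0 sg] := segment_arc.
have Sc := chart_at_atlas S (foot v).
have -> : (C * (b - a))%:E = (\int[lebesgue_measure]_(x in `[a, b[) C%:E)%E.
  by rewrite integral_cst//= lebesgue_measure_itv/= lte_fin ab EFinM.
apply: ge0_le_integral_lower => t tab.
  exact: (admissible_Frvelocity_ge0 hF segment_admissible).
move: tab; rewrite /= in_itv/= lee_fin => /andP[at_ tb].
have tab : a <= t <= b by rewrite at_ ltW.
have [ct _ FC] := eC (line_ab tab) uv.
rewrite (smooth_arc_rvelocity e'0 sg _ Sc)//.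
- by have [-> ->] := segment_velocity tab.
- by rewrite at_.
- exact: cinv_dom.
Qed.

End segment.
End segments.

Section real_auxiliary.
Variable R : realType.

Lemma exists_small_pos (X Y e r : R) : 0 <= X -> 0 <= Y -> 0 < e -> 0 < r ->
  exists h, [/\ 0 < h, h * X < e & h * Y < r].
Proof.
move=> X0 Y0 e0 r0; pose h := Num.min (e / (X + 1)) (r / (Y + 1)).
have h0 : 0 < h by rewrite lt_min !divr_gt0// ltr_wpDl.
exists h; split=> //.
- have : h <= e / (X + 1) by rewrite /h ge_min lexx.
  rewrite ler_pdivlMr ?ltr_wpDl//; apply: lt_le_trans.
  by rewrite ltr_pM2l// ltrDl.
- have : h <= r / (Y + 1) by rewrite /h ge_min lexx orbT.
  rewrite ler_pdivlMr ?ltr_wpDl//; apply: lt_le_trans.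
  by rewrite ltr_pM2l// ltrDl.
Qed.

Lemma difference_quotient (V : normedModType R) (x : R -> V) t (e : R) :
  differentiable x t -> 0 < e ->
  \forall s \near t, s != t -> `|(s - t)^-1 *: (x s - x t) - 'D_1 x t| < e.
Proof.
move=> /derivable1_diffP dx e0.
have /cvgrPdist_lt/(_ _ e0) : h^-1 *: ((x \o shift t) (h *: 1) - x t) @[h --> 0^']
    --> 'D_1 x t by exact: dx.
move=> /nbhs_ballP[r /= r0 rP]; apply/nbhs_ballP; exists r => //= s ts st.
rewrite distrC; have := rP (s - t); rewrite /= [_%:A]mulr1 subrK; apply.
  by move: ts; rewrite -!ball_normE/= sub0r opprB.
by rewrite subr_eq0.
Qed.

Lemma nbhs_at_left (t : R) (P : set R) : nbhs t P -> t^'- P.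
Proof. by apply: filterS => s Ps _. Qed.

Lemma nbhs_at_right (t : R) (P : set R) : nbhs t P -> t^'+ P.
Proof. by apply: filterS => s Ps _. Qed.

End real_auxiliary.

(** * Short separations and openness of the balls *)

Section balls.
Context (R : realType) (n : nat) (M : topologicalType).
Variables (S : smooth_manifold R n M) (A : set (TM S)) (F : TM S -> R).
Hypothesis hF : conic_pseudo_Finsler A F.

Lemma line_start (V : normedModType R) (x u : V) (a : R) : line x u a a = x.
Proof. by rewrite /line subrr scale0r addr0. Qed.

(** Some [v] in [A] lies above [q]; the segment of velocity [v] leaving [q], respectively arriving
    at [q], costs at most [C] times its duration [h]. *)
Lemma separation_short_curves q (r : R) : 0 < r ->
  (exists p, (separation A F q p < r%:E)%E) /\
  (exists p, (separation A F p q < r%:E)%E).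
Proof.
move=> r0.
have [v Av vq] : exists2 v, A v & foot v = q.
  by have : [set: M] q by []; rewrite -(cpF_foot hF) => -[v Av <-]; exists v.
have [e [C [e0 C0 eC]]] := tangent_cone_nbhs hF Av.
have dc := chart_at_dom S (foot v).
set c := chart_at S (foot v) in eC dc; set x0 := cmap c (foot v) in eC.
have cq : cinv c x0 = q by rewrite -vq cmapK.
have [h [h0 he hr]] := exists_small_pos (normr_ge0 (vec v)) C0 e0 r0.
have x0e : ball x0 e x0 by exact: ballxx.
have ve : ball (vec v) e (vec v) by exact: ballxx.
split.
- have h1 : ball x0 e (line x0 (vec v) 0 0) by rewrite line_start.
  have h2 : ball x0 e (line x0 (vec v) 0 h).
    rewrite /line subr0 -ball_normE/= opprD addrA subrr add0r normrN normrZ.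
    by rewrite gtr0_norm.
  have adm := segment_admissible eC h0 h1 h2 ve.
  have len := segment_Flength hF eC h0 h1 h2 ve.
  exists (cinv c (line x0 (vec v) 0 h)).
  have := separation_le_Flength F adm; rewrite /= line_start cq => le1.
  apply: le_lt_trans (le_trans le1 len) _.
  by rewrite lte_fin subr0 mulrC.
(* The starting point is chosen so that the segment of velocity [v] reaches [x0] exactly at time
   [h]. *)
- pose x1 := x0 - h *: vec v.
  have h1 : ball x0 e (line x1 (vec v) 0 0).
    rewrite line_start -ball_normE/= /x1 opprB addrC subrK normrZ.
    by rewrite gtr0_norm.
  have l2 : line x1 (vec v) 0 h = x0 by rewrite /line subr0 /x1 subrK.
  have h2 : ball x0 e (line x1 (vec v) 0 h) by rewrite l2.
  have adm := segment_admissible eC h0 h1 h2 ve.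
  have len := segment_Flength hF eC h0 h1 h2 ve.
  exists (cinv c x1).
  have := separation_le_Flength F adm; rewrite /= line_start l2 cq => le1.
  apply: le_lt_trans (le_trans le1 len) _.
  by rewrite lte_fin subr0 mulrC.
Qed.

Lemma nbhs_cmap_ball (c : chart R n M) q (e : R) : cdom c q -> 0 < e ->
  nbhs q (cdom c `&` cmap c @^-1` ball (cmap c q) e).
Proof.
move=> cq e0; apply: filterI.
  by apply: open_nbhs_nbhs; split=> //; exact: cdom_open.
by apply: cmap_continuous; [exact/mem_set|exact: nbhsx_ballx].
Qed.

(** Changing the displacement over a duration [d] by less than [d * (e / 2)] changes the mean
    velocity by less than [e / 2]. The other half of [e] is left for the distance from the original
    mean velocity to [w]. *)
Lemma ball_of_quotient (V : normedModType R) (w y y' : V) (e d : R) : 0 < d ->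
  `|d^-1 *: y - w| < e / 2 -> `|y' - y| < d * (e / 2) -> ball w e (d^-1 *: y').
Proof.
move=> d0 h1 h2; rewrite -ball_normE/= distrC.
have -> : d^-1 *: y' - w = d^-1 *: (y' - y) + (d^-1 *: y - w).
  by rewrite scalerBr addrA subrK.
apply: le_lt_trans (ler_normD _ _) _; rewrite [ltRHS]splitr ltrD//.
by rewrite normrZ gtr0_norm ?invr_gt0// mulrC ltr_pdivrMr// mulrC.
Qed.

Lemma separation_near_target p q (r : R) : (separation A F p q < r%:E)%E ->
  \forall q' \near q, (separation A F p q' < r%:E)%E.
Proof.
move=> /separation_lt[a [b [alpha [adm alphaa alphab Lr]]]].
have [ab /piecewise_smoothP pw _ Al] := adm.
pose v := lvelocity S alpha b.
have Av : A v by apply: Al; rewrite in_itv/= ab lexx.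
have vq : foot v = q by [].
have [e [C [e0 C0 eC]]] := tangent_cone_nbhs hF Av.
have Sc := chart_at_atlas S (foot v).
have dc := chart_at_dom S (foot v).
set c := chart_at S (foot v) in eC Sc dc; set x0 := cmap c (foot v) in eC.
have [t0 t0b [e1 [beta [e10 sb eqb]]]] := arcs_last ab pw.
have bb : t0 <= b <= b by rewrite lexx ltW.
have betab : beta b = foot v by rewrite -eqb ?in_itv.
have cb : cdom c (beta b) by rewrite betab.
have db := smooth_curve_differentiable sb Sc (mem_smooth_arc e10 bb) cb.
have Dv : 'D_1 (cmap c \o beta) b = vec v.
  rewrite [in RHS]/v (smooth_arc_lvelocity e10 sb eqb Sc _ cb) ?t0b ?lexx//.
  by rewrite betab chart_vec_at.
pose L := fine (Flength F a b alpha).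
have LE : Flength F a b alpha = L%:E.
  rewrite fineK// ge0_fin_numE; last exact: (Flength_ge0 hF).
  by rewrite (lt_trans Lr)// ltry.
have rL0 : 0 < r - L by rewrite subr_gt0 -lte_fin -LE.
have e20 : 0 < e / 2 by rewrite divr_gt0.
have dq := difference_quotient db e20.
have nx : \forall s \near b, ball x0 e (cmap c (beta s)).
  have := differentiable_continuous db; apply.
  by rewrite /= betab; exact: nbhsx_ballx.
have nc := near_cdom (smooth_arc_continuous e10 sb bb) cb.
(* The part of the curve that is kept costs at most [L], so [r - L] is the budget for the new
   segment; [h] bounds its duration accordingly. *)
have [h [h0 hC _]] := exists_small_pos C0 C0 rL0 rL0.
have [s [as_ t0s sb' sh [nds xs cs]]] : exists s, [/\ a < s, t0 < s, s < b,
    (b - s) * C < r - L & [/\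
      `|(s - b)^-1 *: (cmap c (beta s) - cmap c (beta b)) - vec v| < e / 2,
      ball x0 e (cmap c (beta s)) & cdom c (beta s)]].
  near b^'- => s; exists s.
  have sb' : s < b by near: s; exact: nbhs_left_lt.
  have as_ : a < s by near: s; exact: nbhs_left_gt.
  have t0s : t0 < s by near: s; exact: nbhs_left_gt.
  split=> //.
  - apply: le_lt_trans hC; rewrite ler_wpM2r//.
    have : b - h < s by near: s; apply: nbhs_left_gt; rewrite ltrBlDr ltrDl.
    by move=> ?; lra.
  - split.
    + have : s != b by rewrite lt_eqF.
      by rewrite -Dv; near: s; exact: (nbhs_at_left dq).
    + by near: s; exact: (nbhs_at_left nx).
    + by near: s; exact: (nbhs_at_left nc).
have bs0 : 0 < b - s by rewrite subr_gt0.
have betas : alpha s = beta s by rewrite eqb// in_itv/= !ltW.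
have cq : cdom c q by rewrite -vq.
have nq : nbhs q (cdom c `&` cmap c @^-1` ball (cmap c q) e).
  exact: nbhs_cmap_ball.
(* The cutting time [s] is fixed before [q'], so this neighbourhood may shrink with [b - s]. *)
have nq' : nbhs q (cdom c `&` cmap c @^-1` ball (cmap c q) ((b - s) * (e / 2))).
  by apply: nbhs_cmap_ball => //; rewrite mulr_gt0.
near=> q'.
have [cq' xq'] : (cdom c `&` cmap c @^-1` ball (cmap c q) e) q' by near: q'.
have [_ xq''] : (cdom c `&` cmap c @^-1` ball (cmap c q) ((b - s) * (e / 2))) q'.
  by near: q'.
(* The constant velocity that leads from [beta s] to [q'] in the remaining time. It is close to the
   mean velocity of the curve from [s] to [b], itself close to [v]. *)
pose u := (b - s)^-1 *: (cmap c q' - cmap c (beta s)).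
have ls : line (cmap c (beta s)) u s s = cmap c (beta s) by exact: line_start.
have lb : line (cmap c (beta s)) u s b = cmap c q'.
  by rewrite /line /u scalerA divff ?gt_eqF// scale1r addrC subrK.
have uv : ball (vec v) e u.
  apply: (@ball_of_quotient _ _ (cmap c (beta b) - cmap c (beta s))) => //.
    by rewrite -(opprB s b) invrN scaleNr -scalerN opprB.
  by rewrite opprB addrA subrK betab vq distrC; move: xq''; rewrite -ball_normE.
have h1 : ball x0 e (line (cmap c (beta s)) u s s) by rewrite ls.
have h2 : ball x0 e (line (cmap c (beta s)) u s b) by rewrite lb /x0 vq.
have adm1 := segment_admissible eC sb' h1 h2 uv.
have len1 := segment_Flength hF eC sb' h1 h2 uv.
have adm0 := admissible_sub (lexx a) as_ (ltW sb') adm.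
have len0 := Flength_sub hF (lexx a) (ltW sb') adm.
have := separation_glue hF adm0 adm1; rewrite /= ls lb !cmapK// alphaa.
move=> /(_ betas) le1; apply: le_lt_trans le1 _.
apply: le_lt_trans (leeD len0 len1) _.
by rewrite LE -EFinD lte_fin -ltrBrDl mulrC.
Unshelve. all: by end_near. Qed.

(** The same surgery at the initial end: the right velocity at [a] plays the role of [v], and the
    segment comes first in the concatenation. *)
Lemma separation_near_source p q (r : R) : (separation A F q p < r%:E)%E ->
  \forall q' \near q, (separation A F q' p < r%:E)%E.
Proof.
move=> /separation_lt[a [b [alpha [adm alphaa alphab Lr]]]].
have [ab /piecewise_smoothP pw Ar _] := adm.
pose v := rvelocity S alpha a.
have Av : A v by apply: Ar; rewrite in_itv/= ab lexx.
have vq : foot v = q by [].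
have [e [C [e0 C0 eC]]] := tangent_cone_nbhs hF Av.
have Sc := chart_at_atlas S (foot v).
have dc := chart_at_dom S (foot v).
set c := chart_at S (foot v) in eC Sc dc; set x0 := cmap c (foot v) in eC.
have [t1 at1 [e1 [beta [e10 sb eqb]]]] := arcs_first ab pw.
have aa : a <= a <= t1 by rewrite lexx ltW.
have betaa : beta a = foot v by rewrite -eqb ?in_itv.
have ca : cdom c (beta a) by rewrite betaa.
have da := smooth_curve_differentiable sb Sc (mem_smooth_arc e10 aa) ca.
have Dv : 'D_1 (cmap c \o beta) a = vec v.
  rewrite [in RHS]/v (smooth_arc_rvelocity e10 sb eqb Sc _ ca) ?at1 ?lexx//.
  by rewrite betaa chart_vec_at.
pose L := fine (Flength F a b alpha).
have LE : Flength F a b alpha = L%:E.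
  rewrite fineK// ge0_fin_numE; last exact: (Flength_ge0 hF).
  by rewrite (lt_trans Lr)// ltry.
have rL0 : 0 < r - L by rewrite subr_gt0 -lte_fin -LE.
have e20 : 0 < e / 2 by rewrite divr_gt0.
have dq := difference_quotient da e20.
have nx : \forall s \near a, ball x0 e (cmap c (beta s)).
  have := differentiable_continuous da; apply.
  by rewrite /= betaa; exact: nbhsx_ballx.
have nc := near_cdom (smooth_arc_continuous e10 sb aa) ca.
have [h [h0 hC _]] := exists_small_pos C0 C0 rL0 rL0.
have [s [as_ st1 sb' sh [nds xs cs]]] : exists s, [/\ a < s, s < t1, s < b,
    (s - a) * C < r - L & [/\
      `|(s - a)^-1 *: (cmap c (beta s) - cmap c (beta a)) - vec v| < e / 2,
      ball x0 e (cmap c (beta s)) & cdom c (beta s)]].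
  near a^'+ => s; exists s.
  have as_ : a < s by near: s; exact: nbhs_right_gt.
  have st1 : s < t1 by near: s; exact: nbhs_right_lt.
  have sb' : s < b by near: s; exact: nbhs_right_lt.
  split=> //.
  - apply: le_lt_trans hC; rewrite ler_wpM2r//.
    have : s < a + h by near: s; apply: nbhs_right_lt; rewrite ltrDl.
    by move=> ?; lra.
  - split.
    + have : s != a by rewrite gt_eqF.
      by rewrite -Dv; near: s; exact: (nbhs_at_right dq).
    + by near: s; exact: (nbhs_at_right nx).
    + by near: s; exact: (nbhs_at_right nc).
have sa0 : 0 < s - a by rewrite subr_gt0.
have betas : beta s = alpha s by rewrite eqb// in_itv/= !ltW.
have cq : cdom c q by rewrite -vq.
have nq : nbhs q (cdom c `&` cmap c @^-1` ball (cmap c q) e).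
  exact: nbhs_cmap_ball.
have nq' : nbhs q (cdom c `&` cmap c @^-1` ball (cmap c q) ((s - a) * (e / 2))).
  by apply: nbhs_cmap_ball => //; rewrite mulr_gt0.
near=> q'.
have [cq' xq'] : (cdom c `&` cmap c @^-1` ball (cmap c q) e) q' by near: q'.
have [_ xq''] : (cdom c `&` cmap c @^-1` ball (cmap c q) ((s - a) * (e / 2))) q'.
  by near: q'.
pose u := (s - a)^-1 *: (cmap c (beta s) - cmap c q').
have la : line (cmap c q') u a a = cmap c q' by exact: line_start.
have ls : line (cmap c q') u a s = cmap c (beta s).
  by rewrite /line /u scalerA divff ?gt_eqF// scale1r addrC subrK.
have uv : ball (vec v) e u.
  apply: (@ball_of_quotient _ _ (cmap c (beta s) - cmap c (beta a))) => //.
  rewrite opprB addrC addrA subrK betaa vq.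
  by move: xq''; rewrite -ball_normE.
have h1 : ball x0 e (line (cmap c q') u a a) by rewrite la /x0 vq.
have h2 : ball x0 e (line (cmap c q') u a s) by rewrite ls.
have adm1 := segment_admissible eC as_ h1 h2 uv.
have len1 := segment_Flength hF eC as_ h1 h2 uv.
have adm0 := admissible_sub (ltW as_) sb' (lexx b) adm.
have len0 := Flength_sub hF (ltW as_) (lexx b) adm.
have := separation_glue hF adm1 adm0; rewrite /= la ls !cmapK// alphab.
move=> /(_ betas) le1; apply: le_lt_trans le1 _.
apply: le_lt_trans (leeD len1 len0) _.
by rewrite LE -EFinD lte_fin -ltrBrDr mulrC.
Unshelve. all: by end_near. Qed.

Lemma open_fball p r : open (fball A F p r).
Proof. by rewrite openE => q /separation_near_target. Qed.

Lemma open_bball p r : open (bball A F p r).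
Proof. by rewrite openE => q /separation_near_source. Qed.

End balls.

(** * A C^1 bump function on R^n *)

Section bump.
Context (R : realType) (n : nat).

Lemma rV_norm_le (v : 'rV[R]_n) (r : R) : 0 <= r ->
  (forall i, `|v 0 i| <= r) -> `|v| <= r.
Proof.
move=> r0 vr; rewrite [leLHS]/Num.Def.normr/= mx_normrE.
by apply: bigmax_le => //= -[i j] _ /=; rewrite (ord1 i).
Qed.

Lemma rV_coord_le (v : 'rV[R]_n) i : `|v 0 i| <= `|v|.
Proof.
rewrite [leRHS]/Num.Def.normr/= mx_normrE.
exact: (le_bigmax _ (fun ij => `|v ij.1 ij.2|) (0, i)).
Qed.

Lemma is_derive_sqr (f : R -> R) (t df : R) : is_derive t 1 f df ->
  is_derive t 1 (fun s => f s ^+ 2) (2 * f t * df).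
Proof.
move=> dfx; have -> : (fun s => f s ^+ 2) = f ^+ 2 by apply/funext => s; rewrite exprfctE.
by apply: is_derive_eq; rewrite expr1.
Qed.

(* The truncated square is C^1, which is why the bump below is a square. *)
Lemma is_derive_sqr_max0 (s : R) :
  is_derive s 1 (fun y : R => (Num.max 0 y) ^+ 2) (2 * Num.max 0 s).
Proof.
have /or3P[s0|s0|/eqP s0] : [|| s < 0, 0 < s | s == 0] by case: (ltgtP s 0).
- rewrite max_l ?ltW// mulr0.
  apply: (@near_eq_is_derive _ _ _ (cst 0)).
  have := lt_nbhsl s0; apply: filterS => y y0 /=.
  by rewrite max_l ?ltW// expr0n.
- rewrite max_r ?ltW//.
  have D2 : is_derive s 1 (fun y : R => y ^+ 2) (2 * s).
    by have := is_derive_sqr (is_derive_id s (1 : R)); rewrite mulr1.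
  apply: near_eq_is_derive D2; have := lt_nbhsr s0; apply: filterS => y y0 /=.
  by rewrite max_r ?ltW.
- rewrite s0 maxxx mulr0.
  have D : (fun h : R => h^-1 *: ((Num.max 0 (h *: (1 : R) + 0 : R)) ^+ 2
      - (Num.max 0 (0 : R)) ^+ 2)) @ 0^' --> (0 : R).
    apply/cvgrPdist_lt => /= e e0; near=> h.
    rewrite sub0r normrN maxxx expr0n/= subr0 addr0 [h%:A]mulr1.
    have he : `|h| < e by near: h; exact: dnbhs0_lt.
    have h0 : h != 0 by near: h; exact: nbhs_dnbhs_neq.
    have /orP[hneg|hpos] : (h < 0) || (0 < h) by rewrite -neq_lt.
      by rewrite max_l ?ltW// expr0n/= scaler0 normr0.
    by rewrite max_r ?ltW// [_ *: _]mulrC expr2 mulfK.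
  by split; [apply/cvg_ex; exists 0|exact: cvg_lim D].
Unshelve. all: by end_near. Qed.

Variables (x0 : 'rV[R]_n) (rho : R).
Hypothesis rho0 : 0 < rho.

(** The Euclidean distance is used because its square is a polynomial, whereas the norm of row
    vectors is the maximum norm. The former dominates the latter, so the bump is still supported in
    a ball of the norm. *)
Definition sqdist (y : 'rV[R]_n) : R := \sum_i (y 0 i - x0 0 i) ^+ 2.

Definition ball_bump (y : 'rV[R]_n) : R := (Num.max 0 (rho ^+ 2 - sqdist y)) ^+ 2.

(* The derivative of [ball_bump] at [y] in the direction [v]. *)
Definition dbump (y v : 'rV[R]_n) : R :=
  2 * Num.max 0 (rho ^+ 2 - sqdist y) *
  - \sum_i 2 * (y 0 i - x0 0 i) * v 0 i.

Lemma bump_center : 0 < ball_bump x0.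
Proof.
rewrite /ball_bump /sqdist big1 => [|i _]; last by rewrite subrr expr0n.
by rewrite subr0 max_r ?sqr_ge0// !exprn_gt0.
Qed.

Lemma sqdist_ball y : sqdist y < rho ^+ 2 -> `|y - x0| <= rho.
Proof.
move=> yr; apply: rV_norm_le; first exact: ltW.
move=> i; rewrite !mxE -(@ler_pXn2r _ 2) ?nnegrE ?(ltW rho0)// real_normK ?num_real//.
apply: le_trans (ltW yr); rewrite /sqdist (bigD1 i)//= lerDl.
by apply: sumr_ge0 => j _; exact: sqr_ge0.
Qed.

Lemma max_bump_out y : rho < `|y - x0| -> Num.max 0 (rho ^+ 2 - sqdist y) = 0.
Proof.
move=> yr; apply: max_l; rewrite subr_le0 leNgt; apply/negP => /sqdist_ball.
by rewrite leNgt yr.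
Qed.

Lemma bump_out y : rho < `|y - x0| -> ball_bump y = 0.
Proof. by move=> /max_bump_out; rewrite /ball_bump => ->; rewrite expr0n. Qed.

Lemma dbump_out y v : rho < `|y - x0| -> dbump y v = 0.
Proof. by move=> /max_bump_out; rewrite /dbump => ->; rewrite mulr0 mul0r. Qed.

(** Where the truncated factor is nonzero it is at most [rho ^+ 2], and each of the [n] coordinates
    of [y - x0] is at most [rho]; the constant is [2 * rho ^+ 2] times [n * (2 * rho)]. *)
Lemma dbump_bound y v : `|dbump y v| <= 4 * n%:R * rho ^+ 3 * `|v|.
Proof.
have [yr|yr] := ltP (sqdist y) (rho ^+ 2); last first.
  rewrite /dbump max_l ?subr_le0// mulr0 mul0r normr0.
  have r3 : 0 <= rho ^+ 3 by apply/exprn_ge0/ltW.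
  by do 2?[rewrite mulr_ge0//].
have sq0 : 0 <= sqdist y by apply: sumr_ge0 => i _; exact: sqr_ge0.
rewrite /dbump !normrM normrN gtr0_norm// ger0_norm ?le_max ?lexx//.
have m1 : Num.max 0 (rho ^+ 2 - sqdist y) <= rho ^+ 2.
  by rewrite ge_max sqr_ge0/= lerBlDr lerDl.
have m2 : `|\sum_i 2 * (y 0 i - x0 0 i) * v 0 i| <= n%:R * (2 * rho * `|v|).
  apply: le_trans (ler_norm_sum _ _ _) _.
  have -> : n%:R * (2 * rho * `|v|) = \sum_(i < n) (2 * rho * `|v|).
    by rewrite sumr_const card_ord mulr_natl.
  apply: ler_sum => i _; rewrite !normrM gtr0_norm//.
  apply: ler_pM => //; rewrite ?mulr_ge0//; last exact: rV_coord_le.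
  rewrite ler_pM2l//; apply: le_trans (sqdist_ball yr).
  by have := rV_coord_le (y - x0) i; rewrite !mxE.
have -> : 4 * n%:R * rho ^+ 3 * `|v| = (2 * rho ^+ 2) * (n%:R * (2 * rho * `|v|)).
  by ring.
apply: ler_pM => //; first by rewrite mulr_ge0// le_max lexx.
by rewrite ler_pM2l.
Qed.

Lemma is_derive_bump (x : R -> 'rV[R]_n) t : differentiable x t ->
  is_derive t 1 (ball_bump \o x) (dbump (x t) ('D_1 x t)).
Proof.
move=> /derivable1_diffP dx.
have dxi i : is_derive t 1 (fun s => x s 0 i) ('D_1 x t 0 i).
  rewrite derive_mx// mxE; apply: derivableP.
  by move/derivable_mxP : dx; apply.
have dsq i : is_derive t 1 (fun s => (x s 0 i - x0 0 i) ^+ 2)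
    (2 * (x t 0 i - x0 0 i) * 'D_1 x t 0 i).
  have db : is_derive t 1 (fun s => x s 0 i - x0 0 i) ('D_1 x t 0 i).
    by apply: is_derive_eq; rewrite subr0.
  exact: is_derive_sqr.
have dsum : is_derive t 1 (sqdist \o x)
    (\sum_i 2 * (x t 0 i - x0 0 i) * 'D_1 x t 0 i).
  have -> : sqdist \o x = \sum_(i < n) (fun s => (x s 0 i - x0 0 i) ^+ 2).
    by apply/funext => s; rewrite fct_sumE.
  exact: is_derive_sum.
have din : is_derive t 1 (fun s => rho ^+ 2 - sqdist (x s))
    (- \sum_i 2 * (x t 0 i - x0 0 i) * 'D_1 x t 0 i).
  by have := is_deriveB (is_derive_cst (rho ^+ 2 : R) t 1) dsum; rewrite sub0r.
have dout := is_derive_sqr_max0 (rho ^+ 2 - sqdist (x t)).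
exact: (@is_derive1_comp R _ (fun s => rho ^+ 2 - sqdist (x s)) _ _ _ dout din).
Qed.

(** Continuity of the derivative along a curve is what the fundamental theorem of calculus will
    require. *)
Lemma continuous_dbump (x v : R -> 'rV[R]_n) t :
  {for t, continuous x} -> {for t, continuous v} ->
  {for t, continuous (fun s => dbump (x s) (v s))}.
Proof.
move=> cx cv.
have cxi i : {for t, continuous (fun s => x s 0 i - x0 0 i)}.
  apply: cvgB; last exact: cvg_cst.
  exact: (continuous_comp cx (@coord_continuous _ _ _ _ _ _)).
have cvi i : {for t, continuous (fun s => v s 0 i)}.
  exact: (continuous_comp cv (@coord_continuous _ _ _ _ _ _)).
have cm : {for t, continuous (fun s => Num.max 0 (rho ^+ 2 - sqdist (x s)))}.
  apply: continuous_max; first exact: cvg_cst.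
  apply: cvgB; first exact: cvg_cst.
  apply: cvg_big => [|i _]; first exact: add_continuous.
  by rewrite expr2; under eq_cvg do rewrite expr2; exact: cvgM (cxi i) (cxi i).
apply: cvgM.
  by apply: cvgM => //; exact: cvg_cst.
apply: cvgN; apply: cvg_big => [|i _]; first exact: add_continuous.
apply: cvgM; last exact: cvi.
by apply: cvgM; [exact: cvg_cst|exact: cxi].
Qed.

End bump.

(** * Riemannian lower bound *)

Section Riemannian.
Context (R : realType) (n : nat) (M : topologicalType).
Variables (S : smooth_manifold R n M) (g : M -> 'rV[R]_n -> 'rV[R]_n -> R).
Hypothesis hg : Riemannian_metric S g.

Lemma Riem_sum (p : M) (I : finType) (a : I -> R) (u : I -> 'rV[R]_n) w :
  g p (\sum_i a i *: u i) w = \sum_i a i * g p (u i) w.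
Proof.
apply: (big_ind2 (fun x y => g p x w = y)) => //.
(* Linearity at zero vectors reads [g p 0 w = g p 0 w + g p 0 w], whence [g p 0 w = 0]. *)
- have := Riem_linear hg p 1 0 0 w; rewrite scaler0 addr0 mul1r => H.
  by apply: (@addrI _ (g p 0 w)); rewrite -H addr0.
- by move=> x1 x2 y1 y2 <- <-; have := Riem_linear hg p 1 x1 y1 w; rewrite scale1r mul1r.
- move=> i _; have := Riem_linear hg p (a i) (u i) 0 w; rewrite addr0 => ->.
  have := Riem_linear hg p 1 0 0 w; rewrite scaler0 addr0 mul1r => H.
  suff -> : g p 0 w = 0 by rewrite addr0.
  by apply: (@addrI _ (g p 0 w)); rewrite -H addr0.
Qed.

Variable c : chart R n M.
Hypothesis Sc : atlas S c.

Definition chart_metric (x u w : 'rV[R]_n) : R :=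
  g (cinv c x) (vec (chart_vec S c x u)) (vec (chart_vec S c x w)).

Lemma vec_chart_vec_sum x (u : 'rV[R]_n) : ctgt c x ->
  vec (chart_vec S c x u) =
    \sum_i u 0 i *: vec (chart_vec S c x (delta_mx 0 i)).
Proof.
move=> cx; have dT : differentiable (cmap (chart_at S (cinv c x)) \o cinv c) x.
  exact: (transition_differentiable Sc (chart_at_atlas S _) cx (chart_at_dom S _)).
rewrite /= deriveE// {1}(row_sum_delta u) linear_sum; apply: eq_bigr => i _.
by rewrite linearZ deriveE.
Qed.

Lemma chart_metricE x u : ctgt c x -> chart_metric x u u =
  \sum_i \sum_j u 0 i * u 0 j * chart_metric x (delta_mx 0 i) (delta_mx 0 j).
Proof.
move=> cx; rewrite /chart_metric (vec_chart_vec_sum u cx) Riem_sum.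
apply: eq_bigr => i _; rewrite (Riem_sym hg) Riem_sum mulr_sumr.
by apply: eq_bigr => j _; rewrite mulrA (Riem_sym hg).
Qed.

Lemma chart_metric_scale x u (a : R) : ctgt c x ->
  chart_metric x (a *: u) (a *: u) = a ^+ 2 * chart_metric x u u.
Proof.
move=> cx; rewrite !chart_metricE// mulr_sumr; apply: eq_bigr => i _.
rewrite mulr_sumr; apply: eq_bigr => j _; rewrite !mxE; ring.
Qed.

(** [Riem_smooth] gives continuity in the position for fixed vectors only. Expanding in the
    canonical basis yields a polynomial in [u] whose coefficients are continuous in the position,
    hence joint continuity. *)
Lemma chart_metric_continuous x u : ctgt c x ->
  {for (x, u), continuous (fun z : 'rV[R]_n * 'rV[R]_n =>
    chart_metric z.1 z.2 z.2)}.
Proof.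
move=> cx.
pose h (z : 'rV[R]_n * 'rV[R]_n) := \sum_i \sum_j z.2 0 i * z.2 0 j *
  chart_metric z.1 (delta_mx 0 i) (delta_mx 0 j).
have hE : \forall z \near (x, u), chart_metric z.1 z.2 z.2 = h z.
  have : \forall z \near (x, u), ctgt c z.1.
    apply: (@cvg_fst _ _ (nbhs x) (nbhs u)).
    by apply: open_nbhs_nbhs; split=> //; exact: ctgt_open.
  by apply: filterS => z; exact: chart_metricE.
suff ch : {for (x, u), continuous h}.
  have /= hxu := nbhs_singleton hE; rewrite /prop_for /continuous_at /= hxu.
  apply: cvg_trans ch.
  by apply: near_eq_cvg; apply: filterS hE => z ->.
have c2 k : {for (x, u), continuous (fun z : 'rV[R]_n * 'rV[R]_n => z.2 0 k)}.
  apply: (@continuous_comp _ _ _ snd (fun w : 'rV[R]_n => w 0 k)).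
    exact: cvg_snd.
  exact: coord_continuous.
apply: cvg_big => [|i _]; first exact: add_continuous.
apply: cvg_big => [|j _]; first exact: add_continuous.
apply: cvgM; first exact: cvgM (c2 i) (c2 j).
apply: (@continuous_comp _ _ _ fst
  (fun y => chart_metric y (delta_mx 0 i) (delta_mx 0 j))).
  exact: cvg_fst.
have := Riem_smooth hg Sc (delta_mx 0 i) (delta_mx 0 j) 0; apply.
exact/mem_set.
Qed.

End Riemannian.

Section lower_bound.
Context (R : realType) (n : nat) (M : topologicalType).
Variables (S : smooth_manifold R n M) (g : M -> 'rV[R]_n -> 'rV[R]_n -> R).
Hypothesis hg : Riemannian_metric S g.

Lemma compact_sphere : compact [set u : 'rV[R]_n | `|u| = 1].
Proof.
apply: bounded_closed_compact.
  by exists 1; split=> // y y1 u /= ->; exact: ltW.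
apply: (@closed_comp _ _ (fun u : 'rV[R]_n => `|u|) [set y | y = 1]).
  by move=> u _; exact: norm_continuous.
exact: closed_eq.
Qed.

(** The metric is positive on the compact unit sphere at [q], so it has a positive lower bound there
    that persists at nearby positions; homogeneity extends it to all vectors. *)
Lemma chart_metric_lower_bound q (c := chart_at S q) :
  exists2 l : R, 0 < l & \forall x \near cmap c q,
    forall u, l * `|u| <= Num.sqrt (chart_metric S g c x u u).
Proof.
have Sc : atlas S c := chart_at_atlas S q.
have cq : cdom c q := chart_at_dom S q.
have ctq := cmap_tgt cq.
have nct : \forall x \near cmap c q, ctgt c x.
  by apply: open_nbhs_nbhs; split=> //; exact: ctgt_open.
pose P (i : 'rV[R]_n * R) (u : 'rV[R]_n) := i.2 <= chart_metric S g c i.1 u u.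
(* The parameter of the covering is the pair (position, constant): a local bound valid for all small
   constants becomes one neighbourhood and one constant for the whole sphere. *)
have /compact_near_coveringP/(_ _ (filter_prod (nbhs (cmap c q)) 0^'+) P) :=
  compact_sphere.
move=> /(_ _)[].
  move=> u /= u1.
  have G0 : 0 < chart_metric S g c (cmap c q) u u.
    (* At [q] the chart [c] is the preferred one, so [u] is its own coordinate vector and positivity
       of [g] applies. *)
    rewrite /chart_metric (chart_vec_at (Tangent S q u)) cmapK//.
    by apply: (Riem_pos hg); rewrite -normr_eq0 u1 oner_eq0.
  have cG := chart_metric_continuous hg Sc (u := u) ctq.
  set m := chart_metric S g c (cmap c q) u u in G0.
  have : \forall z \near (cmap c q, u), m / 2 < chart_metric S g c z.1 z.2 z.2.
    apply: (cG [set y | m / 2 < y]); apply: open_nbhs_nbhs; split.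
      exact: open_gt.
    by rewrite /= ltr_pdivrMr// ltr_pMr// ltr1n.
  case=> -[/= Q1 Q2] [nQ1 nQ2] QG.
  exists (Q2, (Q1 `*` [set l | l < m / 2])) => /=.
    split=> //; exists (Q1, [set l | l < m / 2]) => //=; split=> //.
    by apply: nbhs_right_lt; rewrite divr_gt0.
  move=> [u' [x l]] /= [Q2u' [Q1x /ltW lm]]; rewrite /P/=.
  by apply: le_trans lm _; apply: ltW; exact: (QG (x, u')).
move=> [/= Q1 Q2] [nQ1 nQ2] QP.
have [l [l0 Q2l]] : exists l, 0 < l /\ Q2 l.
  near (0 : R)^'+ => l; exists l; split; first by near: l; exact: nbhs_right_gt.
  by near: l.
(* The predicate [P] bounds the squared norm, hence the square root. *)
exists (Num.sqrt l); first by rewrite sqrtr_gt0.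
apply: filterS2 nct nQ1 => x cx Q1x u.
have [->|u0] := eqVneq u 0; first by rewrite normr0 mulr0 sqrtr_ge0.
have un0 : `|u| != 0 by rewrite normr_eq0.
have -> : `|u| = Num.sqrt (`|u| ^+ 2) by rewrite sqrtr_sqr ger0_norm.
rewrite -sqrtrM ?(ltW l0)//; apply: ler_wsqrtr.
have := QP (x, l) (conj Q1x Q2l) (`|u|^-1 *: u).
rewrite /P/= normrZ normfV normr_id mulVf// => /(_ erefl).
rewrite chart_metric_scale// exprVn ler_pdivlMl ?exprn_gt0 ?normr_gt0//.
by rewrite mulrC.
Unshelve. all: by end_near. Qed.

End lower_bound.

(** * A bump function on [M] whose differential is dominated by [F] *)

Section separating_function.
Context (R : realType) (n : nat) (M : topologicalType).
Variables (S : smooth_manifold R n M) (A : set (TM S)) (F : TM S -> R).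
Hypothesis hF : conic_pseudo_Finsler A F.
Variable g : M -> 'rV[R]_n -> 'rV[R]_n -> R.
Hypothesis gF : forall v, A v -> Num.sqrt (g (foot v) (vec v) (vec v)) <= F v.

Section bump_function.
Variables (c : chart R n M) (x0 : 'rV[R]_n) (l rho : R).
Hypotheses (Sc : atlas S c) (l0 : 0 < l) (rho0 : 0 < rho).
Hypothesis ball_ctgt : forall x, `|x - x0| <= rho -> ctgt c x.
Hypothesis ball_metric : forall x, `|x - x0| <= rho ->
  forall u, l * `|u| <= Num.sqrt (chart_metric S g c x u u).

(** Scaled by [k], the bump has a differential bounded by [l] times the norm. The added 1 keeps the
    denominator positive when [n] is 0. *)
Let k := l / (4 * n%:R * rho ^+ 3 + 1).

Definition mbump (p : M) : R :=
  if `[< cdom c p >] then k * ball_bump x0 rho (cmap c p) else 0.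

Let den0 : 0 < 4 * n%:R * rho ^+ 3 + 1.
Proof.
rewrite ltr_wpDl// mulr_ge0//; last by apply/exprn_ge0/ltW.
Qed.

Let k0 : 0 < k.
Proof. by rewrite /k divr_gt0. Qed.

Let supp := cinv c @` [set x | `|x - x0| <= rho].

(** A compact set is closed because [M] is Hausdorff. Hence a point outside the chart domain has a
    neighbourhood avoiding the support, which is why the extension by zero stays C^1 along curves
    that leave the chart. *)
Let closed_supp : closed supp.
Proof.
apply: compact_closed; first exact: (mfd_hausdorff S).
apply: continuous_compact.
  apply: continuous_in_subspaceT => x /set_mem/= xr.
  by apply: cinv_continuous; apply/mem_set/ball_ctgt.
apply: bounded_closed_compact.
  exists (`|x0| + rho); split; first exact: num_real.
  move=> y y1 u /= ur; apply: ltW; apply: le_lt_trans y1.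
  by rewrite -[u](subrK x0) addrC (le_trans (ler_normD _ _))// lerD2l.
have -> : [set x | `|x - x0| <= rho] = closed_ball x0 rho.
  by rewrite closed_ballE//; apply/seteqP; split=> u; rewrite /closed_ball_/= distrC.
exact: closed_ball_closed.
Qed.

Let out_supp p : ~ supp p -> cdom c p -> rho < `|cmap c p - x0|.
Proof.
move=> Np cp; rewrite ltNge; apply/negP => le; apply: Np.
by exists (cmap c p) => //; rewrite cmapK.
Qed.

Lemma mbump_neq0 p : mbump p != 0 -> cdom c p /\ `|cmap c p - x0| <= rho.
Proof.
rewrite /mbump; case: ifPn => [/asboolP cp|_]; last by rewrite eqxx.
move=> h; split=> //; rewrite leNgt; apply/negP => /(bump_out rho0) b0.
by move: h; rewrite b0 mulr0 eqxx.
Qed.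

Section along_curve.
Variables (J : set R) (beta : R -> M).
Hypotheses (oJ : open J) (sb : smooth_curve S J beta).

Let dmbump (t : R) : R := if `[< cdom c (beta t) >] then
  k * dbump x0 rho (cmap c (beta t)) ('D_1 (cmap c \o beta) t) else 0.

Let near_out t : J t -> ~ cdom c (beta t) ->
  \forall s \near t, ~ supp (beta s).
Proof.
move=> Jt nct; have [cb _] := sb.
apply: (cb t (mem_set Jt) (~` supp)); apply: open_nbhs_nbhs; split.
  by rewrite openC.
by move=> [x /= xr] xb; apply: nct; rewrite -xb; exact/cinv_dom/ball_ctgt.
Qed.

Let is_derive_mbump t : J t -> is_derive t 1 (mbump \o beta) (dmbump t).
Proof.
move=> Jt; rewrite /dmbump; case: ifPn => [/asboolP ct|/asboolP nct].
  have db := smooth_curve_differentiable sb Sc Jt ct.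
  have cb : {for t, continuous beta} by apply: sb.1; exact/mem_set.
  have dk := @is_deriveZ R R R _ k t 1 _ (is_derive_bump x0 rho db).
  apply: near_eq_is_derive dk.
  have := near_cdom cb ct; apply: filterS => s cs.
  by rewrite /= /mbump asboolT.
apply: (@near_eq_is_derive _ _ _ (cst 0)).
have := near_out Jt nct; apply: filterS => s ns /=.
rewrite /mbump; case: ifPn => // /asboolP cs.
by rewrite (bump_out rho0) ?mulr0//; exact: out_supp.
Qed.

Let continuous_dmbump t : J t -> {for t, continuous dmbump}.
Proof.
move=> Jt; rewrite /prop_for /continuous_at {2}/dmbump.
have cb : {for t, continuous beta} by apply: sb.1; exact/mem_set.
case: ifPn => [/asboolP ct|/asboolP nct].
  have db := smooth_curve_differentiable sb Sc Jt ct.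
  apply: (@cvg_trans _ ((fun s => k * dbump x0 rho ((cmap c \o beta) s)
      ('D_1 (cmap c \o beta) s)) @ t)).
    apply: near_eq_cvg; have := near_cdom cb ct; apply: filterS => s cs.
    by rewrite /dmbump asboolT.
  have H := @continuous_dbump _ _ x0 rho (cmap c \o beta) ('D_1 (cmap c \o beta)) t
    (differentiable_continuous db) (smooth_curve_derive_continuous sb Sc Jt ct).
  exact: (cvgM (cvg_cst k) H).
apply: cvg_near_cst; have := near_out Jt nct; apply: filterS => s ns.
rewrite /dmbump; case: ifPn => // /asboolP cs.
by rewrite (dbump_out rho0) ?mulr0//; exact: out_supp.
Qed.

Variables (t0 t1 : R).
Hypotheses (t01 : t0 < t1) (Jt : forall t, t0 <= t <= t1 -> J t).

(** Outside the ball of radius [rho] the derivative vanishes. Inside, it is at most [l] times the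
    norm of the velocity in [c], hence at most its Riemannian norm, hence at most [F]. *)
Let dmbump_le alpha t : t0 <= t < t1 ->
  (forall c', atlas S c' -> cdom c' (beta t) -> rvelocity S alpha t =
    chart_vec S c' (cmap c' (beta t)) ('D_1 (cmap c' \o beta) t)) ->
  A (rvelocity S alpha t) -> `|dmbump t| <= F (rvelocity S alpha t).
Proof.
move=> tt rv Av; have Fv0 := cpF_ge0 hF Av; rewrite /dmbump.
case: ifPn => [/asboolP ct|_]; last by rewrite normr0.
have [xr|xr] := ltP rho `|cmap c (beta t) - x0|.
  by rewrite (dbump_out rho0)// mulr0 normr0.
apply: le_trans (gF Av); rewrite (rv _ Sc ct).
apply: le_trans (ball_metric xr _).
rewrite normrM (gtr0_norm k0) /k mulrAC ler_pdivrMr// -[leRHS]mulrA ler_pM2l//.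
apply: le_trans (dbump_bound _ rho0 _ _) _; rewrite mulrC ler_wpM2l//.
by rewrite lerDl.
Qed.

Lemma mbump_arc_le alpha :
  (forall t, t0 <= t < t1 -> forall c', atlas S c' -> cdom c' (beta t) ->
    rvelocity S alpha t =
    chart_vec S c' (cmap c' (beta t)) ('D_1 (cmap c' \o beta) t)) ->
  (forall t, t0 <= t < t1 -> A (rvelocity S alpha t)) ->
  (`|mbump (beta t1) - mbump (beta t0)|%:E <= Flength F t0 t1 alpha)%E.
Proof.
move=> rv Av.
have cd : {within `[t0, t1], continuous dmbump}.
  apply: continuous_in_subspaceT => t /set_mem/=; rewrite in_itv/= => tt.
  exact/continuous_dmbump/Jt.
have dg t : t0 <= t <= t1 -> is_derive t 1 (mbump \o beta) (dmbump t).
  by move=> tt; exact/is_derive_mbump/Jt.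
have cg t : t0 <= t <= t1 -> {for t, continuous (mbump \o beta)}.
  move=> tt; apply: differentiable_continuous; apply/derivable1_diffP.
  by have [] := dg _ tt.
have ftc : (\int[lebesgue_measure]_(t in `[t0, t1]) (dmbump t)%:E =
    (mbump (beta t1))%:E - (mbump (beta t0))%:E)%E.
  apply: (continuous_FTC2 (F := mbump \o beta)) => //.
    split.
    - move=> t /[!in_itv]/= /andP[/ltW h1 /ltW h2].
      have [] // : is_derive t 1 (mbump \o beta) (dmbump t).
      by apply: dg; rewrite h1.
    - by apply: cvg_at_right_filter; apply: cg; rewrite lexx ltW.
    - by apply: cvg_at_left_filter; apply: cg; rewrite lexx ltW.
  move=> t /[!in_itv]/= /andP[/ltW h1 /ltW h2].
  have [_ dE] : is_derive t 1 (mbump \o beta) (dmbump t) by apply: dg; rewrite h1.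
  by rewrite derive1E dE.
have md : measurable_fun `[t0, t1] dmbump.
  by apply: subspace_continuous_measurable_fun => //; exact: measurable_itv.
(* At [t1] the right velocity of [alpha] belongs to the next piece, so the comparison with [F] is
   made on the half-open interval; removing one point does not change the integral. *)
have int_dmbump : (\int[lebesgue_measure]_(t in `[t0, t1]) `|(dmbump t)%:E| =
    \int[lebesgue_measure]_(t in `[t0, t1[) `|(dmbump t)%:E|)%E.
  rewrite integral_itv_bndo_bndc//.
  apply: measurableT_comp => //; apply/measurable_EFinP.
  apply: measurable_funS md; first exact: measurable_itv.
  by apply: subset_itv; rewrite bnd_simp.
have := le_abse_integral lebesgue_measure (measurable_itv _)
  ((measurable_EFinP _ _).2 md).
rewrite ftc int_dmbump => le1; apply: le_trans le1 _.
apply: ge0_le_integral_lower => // t /=; rewrite in_itv/= => tt.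
by rewrite lee_fin; apply: dmbump_le => //; [exact: rv|exact: Av].
Qed.

End along_curve.

Lemma mbump_admissible_le a b alpha : admissible A a b alpha ->
  (`|mbump (alpha b) - mbump (alpha a)|%:E <= Flength F a b alpha)%E.
Proof.
move=> [_ /piecewise_smoothP pw Ar _].
elim: pw Ar => {a b} [a|a d b ad [e [beta [e0 sb eqb]]] pw IH] Ar.
  rewrite subrr normr0 integral_ge0// => t /=; rewrite in_itv/=.
  by move=> /andP[/le_lt_trans h /h]; rewrite ltxx.
have db := arcs_le pw.
have Ad t : a <= t < d -> A (rvelocity S alpha t).
  by move=> /andP[at_ td]; apply: Ar; rewrite in_itv/= at_ (lt_le_trans td).
have le1 : (`|mbump (alpha d) - mbump (alpha a)|%:E <= Flength F a d alpha)%E.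
  rewrite !eqb ?in_itv/= ?lexx ?(ltW ad)//.
  apply: (mbump_arc_le (J := `]a - e, d + e[)) => //.
  - by move=> t tt; exact: (mem_smooth_arc e0).
  - by move=> t tt c' Sc' ct; exact: (smooth_arc_rvelocity e0 sb eqb).
have le2 : (`|mbump (alpha b) - mbump (alpha d)|%:E <= Flength F d b alpha)%E.
  apply: IH => t /[!in_itv]/= /andP[dt tb]; apply: Ar.
  by rewrite in_itv/= tb (le_trans (ltW ad)).
rewrite (Flength_split hF (ltW ad) db Ar).
apply: le_trans (leeD le1 le2); rewrite -EFinD lee_fin.
apply: le_trans (ler_normD _ _); rewrite le_eqVlt; apply/orP; left.
by apply/eqP; congr `|_|; ring.
Qed.

End bump_function.

Lemma exists_separating_function (hg : Riemannian_metric S g) q (U : set M) :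
  nbhs q U ->
  exists f : M -> R, [/\ 0 < f q, forall p, f p != 0 -> U p &
    forall a b alpha, admissible A a b alpha ->
      (`|f (alpha b) - f (alpha a)|%:E <= Flength F a b alpha)%E].
Proof.
move=> Uq; pose c := chart_at S q; have Sc : atlas S c := chart_at_atlas S q.
have cq : cdom c q := chart_at_dom S q.
have ctq := cmap_tgt cq.
have [l l0 nl] := chart_metric_lower_bound hg q.
have nct : \forall x \near cmap c q, ctgt c x.
  by apply: open_nbhs_nbhs; split=> //; exact: ctgt_open.
have nU : \forall x \near cmap c q, U (cinv c x).
  by apply: (cinv_continuous (mem_set ctq)); rewrite cmapK.
have nP := filterI nct (filterI nU nl).
have [e /= e0 eP] := (nbhs_ballP _ _).1 (nP _ _).
(* The closed ball of radius [e / 2] lies in the open ball of radius [e], where the three properties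
   hold. *)
pose rho := e / 2; have rho0 : 0 < rho by rewrite divr_gt0.
have H x : `|x - cmap c q| <= rho -> [/\ ctgt c x, U (cinv c x) &
    forall u, l * `|u| <= Num.sqrt (chart_metric S g c x u u)].
  move=> xr; have /eP[? []] : ball (cmap c q) e x; last by split.
  rewrite -ball_normE/= distrC (le_lt_trans xr)//.
  by rewrite ltr_pdivrMr// ltr_pMr// ltr1n.
exists (mbump c (cmap c q) l rho); split.
- rewrite /mbump asboolT// mulr_gt0//; last exact: bump_center.
  rewrite divr_gt0// ltr_wpDl// mulr_ge0//; exact/exprn_ge0/ltW.
- move=> p /(mbump_neq0 rho0)[cp /H[_ Up _]].
  by rewrite -(cmapK cp).
- move=> a b alpha; apply: (@mbump_admissible_le c _ l rho Sc l0 rho0).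
  + by move=> x /H[].
  + by move=> x /H[].
Qed.

End separating_function.

(** * Small balls around every point *)

Section basis.
Context (R : realType) (n : nat) (M : topologicalType).
Variables (S : smooth_manifold R n M) (A : set (TM S)) (F : TM S -> R).
Hypothesis hF : conic_pseudo_Finsler A F.
Hypothesis hlb : lower_bounded A F.

Lemma separating_function_separation q (U : set M) : nbhs q U ->
  exists f : M -> R, [/\ 0 < f q, forall p, f p != 0 -> U p &
    forall p p' (r : R), (separation A F p p' < r%:E)%E -> `|f p' - f p| < r].
Proof.
have [g hg gF] := hlb.
move=> /(exists_separating_function hF gF hg)[f [fq fU fL]].
exists f; split=> // p p' r /separation_lt[a [b [alpha [adm <- <- Lr]]]].
by rewrite -lte_fin; exact: le_lt_trans (fL _ _ _ adm) Lr.
Qed.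

Lemma fball_in q (U : set M) : nbhs q U ->
  exists p (r : R), [/\ 0 < r, fball A F p r q & fball A F p r `<=` U].
Proof.
move=> /separating_function_separation[f [fq fU fL]].
have r0 : 0 < f q / 2 by rewrite divr_gt0.
have [_ [p pq]] := separation_short_curves hF q r0.
exists p, (f q / 2); split=> // q' pq'; apply: fU.
(* As [q] is in the ball, [f p > f q / 2]; as [q'] is, [f q' > f p - f q / 2 > 0]. *)
have := fL _ _ _ pq; have := fL _ _ _ pq'; rewrite !ltr_norml.
move=> /andP[h1 h2] /andP[h3 h4]; rewrite gt_eqF//; lra.
Qed.

Lemma bball_in q (U : set M) : nbhs q U ->
  exists p (r : R), [/\ 0 < r, bball A F p r q & bball A F p r `<=` U].
Proof.
move=> /separating_function_separation[f [fq fU fL]].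
have r0 : 0 < f q / 2 by rewrite divr_gt0.
have [[p qp] _] := separation_short_curves hF q r0.
exists p, (f q / 2); split=> // q' q'p; apply: fU.
have := fL _ _ _ qp; have := fL _ _ _ q'p; rewrite !ltr_norml.
move=> /andP[h1 h2] /andP[h3 h4]; rewrite gt_eqF//; lra.
Qed.

End basis.

Theorem proposition3p13 (R : realType) (n : nat) (M : topologicalType)
    (S : smooth_manifold R n M) (A : set (TM S)) (F : TM S -> R)
    (hM : connected [set: M])
    (hF : conic_pseudo_Finsler A F)
    (hlb : lower_bounded A F) :
  basis [set U : set M | exists (p : M) (r : R), 0 < r /\ U = fball A F p r] /\
  basis [set U : set M | exists (p : M) (r : R), 0 < r /\ U = bball A F p r].
Proof.
split; split.
- by move=> _ [p [r [_ ->]]]; exact: open_fball.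
- move=> q U /(fball_in hF hlb)[p [r [r0 qpr prU]]].
  by exists (fball A F p r) => //; split=> //; exists p, r.
- by move=> _ [p [r [_ ->]]]; exact: open_bball.
- move=> q U /(bball_in hF hlb)[p [r [r0 qpr prU]]].
  by exists (bball A F p r) => //; split=> //; exists p, r.
Qed.
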